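(* Let $F_n$ be a free group of finite rank $n$, let $\mathbb{A}$ be a finitely generated abelian group, and let $\mathcal{H}\leqslant F_n\times\mathbb{A}$ be a finitely generated subgroup given by a finite set of generators. Then: (i) there is an algorithm to decide whether $\mathcal{H}$ has finite index in $F_n\times\mathbb{A}$ and, in the affirmative case, compute the index and a transversal for $\mathcal{H}$ (i.e., the finite index problem for $F_n\times\mathbb{A}$ is solvable); and (ii) $\mathcal{H}$ has a recursive transversal, which can be effectively computed (that is, from the given generators one can compute an algorithm deciding membership in a certain transversal for $\mathcal{H}$ in $F_n\times\mathbb{A}$).
   Context: A transversal for $\mathcal{H}$ in $F_n\times\mathbb{A}$ is a set containing exactly one representative of each right coset of $\mathcal{H}$. A subset of $F_n\times\mathbb{A}$ is recursive if membership in it is algorithmically decidable. *)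

(* Defs.v *)
From HB Require Import structures.
From mathcomp Require Import all_boot.
From mathcomp Require Import boolp classical_sets functions cardinality.

Set Implicit Arguments.
Unset Strict Implicit.
Unset Printing Implicit Defensive.

Local Open Scope group_scope.
Local Open Scope classical_set_scope.

(** * Words and free groups *)

(* [(i, false)] stands for the i-th generator, [(i, true)] for its inverse. *)
Definition word (k : nat) : Type := seq ('I_k * bool).

Definition letter_inv k (x : 'I_k * bool) : 'I_k * bool := (x.1, ~~ x.2).

Definition reduced k (w : seq ('I_k * bool)) : bool :=
  sorted (fun x y => y != letter_inv x) w.

Definition push k (x : 'I_k * bool) (w : seq ('I_k * bool)) :=
  if w is y :: w' then if y == letter_inv x then w' else x :: w else [:: x].

Record free_group (n : nat) : Type :=
  FreeGroup { fg_word :> seq ('I_n * bool); _ : reduced fg_word }.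

HB.instance Definition _ n := [isSub for @fg_word n].
HB.instance Definition _ n := [Choice of free_group n by <:].

Section FreeGroupLaws.
Variable n : nat.
Implicit Types (x y : 'I_n * bool) (u v w : seq ('I_n * bool)).
Implicit Types (g h k : free_group n).

Lemma letter_invK : involutive (@letter_inv n).
Proof. by case=> i b; rewrite /letter_inv /= negbK. Qed.

Lemma reduced_behead x w : reduced (x :: w) -> reduced w.
Proof. exact: path_sorted. Qed.

Lemma push_reduced x w : reduced w -> reduced (push x w).
Proof.
case: w => [//|y w] yw /=; case: ifPn => [_|yx]; first exact: reduced_behead yw.
by rewrite /reduced /= yx.
Qed.

Lemma pushes_reduced u w : reduced w -> reduced (foldr (@push n) w u).
Proof. by move=> rw; elim: u => //= x u; apply: push_reduced. Qed.

Lemma pushK x w : reduced w -> push x (push (letter_inv x) w) = w.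
Proof.
case: w => [|y w] /=; first by rewrite eqxx.
rewrite letter_invK; case: eqVneq => [->|yx] /= => [xw|_].
  by case: w xw => [//|z w] /= /andP[/negbTE-> _].
by rewrite eqxx.
Qed.

Lemma pushes_push x u w : reduced u -> reduced w ->
  foldr (@push n) w (push x u) = push x (foldr (@push n) w u).
Proof.
case: u => [//|y u] ru rw /=; case: eqVneq => [->|//].
by rewrite pushK ?pushes_reduced.
Qed.

Definition word_inv w := rev (map (@letter_inv n) w).

Lemma word_invK : involutive word_inv.
Proof.
move=> w; rewrite /word_inv map_rev revK -map_comp map_id_in // => x _.
exact: letter_invK.
Qed.

Lemma word_inv_reduced w : reduced w -> reduced (word_inv w).
Proof.
rewrite /reduced /word_inv rev_sorted sorted_map.
apply: sub_sorted => x y /= yx.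
by rewrite letter_invK eq_sym.
Qed.

Definition fg_one : free_group n := @FreeGroup n [::] isT.
Definition fg_mul g h : free_group n :=
  FreeGroup (pushes_reduced g (valP h)).
Definition fg_inv g : free_group n := FreeGroup (word_inv_reduced (valP g)).

Lemma fg_mulA : associative fg_mul.
Proof.
move=> [u ru] [v rv] [w rw]; apply: val_inj => /=.
elim: u ru => //= x u IH xu.
by rewrite pushes_push ?pushes_reduced // IH // (reduced_behead xu).
Qed.

Lemma fg_mul1 : left_id fg_one fg_mul.
Proof. by move=> g; apply: val_inj. Qed.

Lemma fg_mulr1 : right_id fg_one fg_mul.
Proof.
case=> u ru; apply: val_inj => /=; elim: u ru => //= x u IH xu.
rewrite IH ?(reduced_behead xu) //.
by case: u xu {IH} => //= y u /andP[/negbTE->].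
Qed.

Lemma fg_mulV : left_inverse fg_one fg_inv fg_mul.
Proof.
case=> u ru; apply: val_inj => /=; elim: u ru => //= x u IH xu.
rewrite /word_inv /= rev_cons -cats1 foldr_cat /= letter_invK eqxx.
exact/IH/(reduced_behead xu).
Qed.

Lemma fg_mulrV : right_inverse fg_one fg_inv fg_mul.
Proof.
move=> g; rewrite -[X in fg_mul X _](_ : fg_inv (fg_inv g) = g) ?fg_mulV //.
by apply: val_inj; rewrite /= word_invK.
Qed.

End FreeGroupLaws.

HB.instance Definition _ n := isGroup.Build (free_group n)
  (@fg_mulA n) (@fg_mul1 n) (@fg_mulr1 n) (@fg_mulV n) (@fg_mulrV n).

Definition fg_gen n (i : 'I_n) : free_group n :=
  @FreeGroup n [:: (i, false)] isT.

Definition eval_word (G : groupType) k (g : 'I_k -> G) (w : word k) : G :=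
  \prod_(l <- w) (if l.2 then (g l.1)^-1 else g l.1).

(** * Subgroups, cosets, transversals *)

Section Cosets.
Variable G : groupType.
Implicit Types H K S T : set G.

Definition is_subgroup K : Prop :=
  K 1 /\ forall x y, K x -> K y -> K (x / y).

Definition generated S : set G := smallest is_subgroup S.

Definition right_coset H (x : G) : set G := [set h * x | h in H].

(* The index of [H] is [k] when [right_cosets H #= `I_k]. *)
Definition right_cosets H : set (set G) := range (right_coset H).

Definition right_transversal H T : Prop :=
  forall C, right_cosets H C -> exists! t, T t /\ C t.

End Cosets.

(** * Algorithms: partial recursive functions on [nat] *)

(* A bijection from [nat * nat] to [nat]; it is compatible with the list
   encoding [CodeSeq.code], see [code_cons]. *)
Definition npair (a b : nat) : nat := (2 ^ a * b.*2.+1).-1.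

Lemma code_cons x s : CodeSeq.code (x :: s) = (npair x (CodeSeq.code s)).+1.
Proof. by rewrite /npair /= prednK // muln_gt0 expn_gt0. Qed.

(* Kleene's partial recursive functions in unary form. *)
Inductive program : Type :=
| PZero
| PSucc
| PFst
| PSnd
| PPair of program & program
| PComp of program & program
| PRec of program & program
| PMu of program.

(* [computes p x y]: on input [x], [p] halts with output [y]. *)
Inductive computes : program -> nat -> nat -> Prop :=
| CZero x : computes PZero x 0
| CSucc x : computes PSucc x x.+1
| CFst a b : computes PFst (npair a b) a
| CSnd a b : computes PSnd (npair a b) b
| CPair p q x y z :
    computes p x y -> computes q x z -> computes (PPair p q) x (npair y z)
| CComp p q x y z :
    computes q x y -> computes p y z -> computes (PComp p q) x z
| CRec0 p q x y :
    computes p x y -> computes (PRec p q) (npair x 0) y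
| CRecS p q x i y z :
    computes (PRec p q) (npair x i) y -> computes q (npair x (npair i y)) z ->
    computes (PRec p q) (npair x i.+1) z
| CMu p x k (f : nat -> nat) :
    (forall i, i < k -> computes p (npair x i) (f i).+1) ->
    computes p (npair x k) 0 ->
    computes (PMu p) x k.

(* Goedel numbers. *)
Fixpoint code_program (p : program) : nat :=
  match p with
  | PZero => npair 0 0
  | PSucc => npair 1 0
  | PFst => npair 2 0
  | PSnd => npair 3 0
  | PPair p q => npair 4 (npair (code_program p) (code_program q))
  | PComp p q => npair 5 (npair (code_program p) (code_program q))
  | PRec p q => npair 6 (npair (code_program p) (code_program q))
  | PMu p => npair 7 (code_program p)
  end.

Definition code_letter k (l : 'I_k * bool) : nat := (l.1.*2 + l.2)%N.
Definition code_word k (w : word k) : nat :=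
  CodeSeq.code [seq code_letter l | l <- w].
Definition code_words k (s : seq (word k)) : nat :=
  CodeSeq.code [seq code_word w | w <- s].

(** * Algorithmic problems in a group [G] with generators [g] *)

Section Problems.
Variables (G : groupType) (k : nat) (g : 'I_k -> G).

Definition listed (s : seq (word k)) : set G :=
  [set x | exists2 w, w \in s & x = eval_word g w].

(* On input [s], with [H] the subgroup generated by [listed s], the output is
   [0] if the index of [H] is infinite; otherwise it is the successor of the
   pair of the index and a list of words representing a transversal. *)
Definition finite_index_problem_solvable : Prop :=
  exists p : program, forall s : seq (word k),
    let H := generated (listed s) in
    (~ finite_set (right_cosets H) /\ computes p (code_words s) 0) \/
    exists (d : nat) (t : seq (word k)),
      [/\ (right_cosets H #= `I_d)%card,
          right_transversal H (listed t) &
          computes p (code_words s) (npair d (code_words t)).+1].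

(* Group elements are given to [c] by arbitrary words representing them. *)
Definition decides (c : program) (T : set G) : Prop :=
  forall w : word k, computes c (code_word w) `[< T (eval_word g w) >].

Definition recursive_transversals_computable : Prop :=
  exists q : program, forall s : seq (word k),
    let H := generated (listed s) in
    exists (c : program) (T : set G),
      [/\ computes q (code_words s) (code_program c),
          right_transversal H T & decides c T].

End Problems.

(* Generators of F_n x A: first the basis of F_n, then those of A. *)
Definition product_gens n (A : groupType) m (a : 'I_m -> A) (i : 'I_(n + m)) :
    (free_group n * A)%type :=
  match fintype.split i with
  | inl j => (fg_gen j, 1)
  | inr j => (1, a j)
  end.

(* Main.v *)
Require Import Defs.
From HB Require Import structures.
From mathcomp Require Import all_boot all_order all_algebra all_fingroup.
From mathcomp Require Import zify ring.
From mathcomp Require Import boolp classical_sets functions cardinality.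
Require Import Defs.

(** Both algorithms are unbounded searches for certificates that a program can
    check; the mathematics lies in showing that the certificates exist.

    Let [G = F_n * A] with the generators of [A] central, and let [H] be the
    subgroup generated by the listed words. The relations of [A] form a subgroup
    of [Z^m], so they follow from finitely many words [R0]; adding these to the
    generators of [H] turns questions about [G] into questions about
    [F_n * Z^m], where the word problem is plain: reduce the free part and count
    the central letters. Membership of [w] in [H] is certified by a product of
    generators equal to the inverse of [w].

    Non-membership and infinite index are certified by finite objects of one
    kind: an action of the generators by permutations of finitely many vertices,
    with weights in [Z/N], where [N = 0] is allowed and means [Z]. If the
    generators of [H] fix the base point and [w] does not, then [w] is not in
    [H]. If [N = 0] and some loop has nonzero weight, then the orbit of the base
    point is infinite, and so is the index of [H].

    Such certificates exist by a variant of Marshall Hall's theorem. Put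
    [L = H A]. Cosets of [L] are cosets of the projection of [H] to [F_n]. Keep
    the finitely many ones visited by the prefixes of the words at hand; the
    generators of [F_n] act on them by partial injections, which extend to
    permutations. The weights come from a homomorphism [L -> Z/N] that kills
    [H]. By the Smith normal form of the lattice of exponents [e] with [a^e] in
    [H], there are enough of them to separate from [H] the elements of [L]
    outside it, and if [H] has infinite index in [L] there is a nonzero one with
    [N = 0]. Lastly, if [L] has infinite index in [G], some edge leaves the
    visited cosets; giving weight [1] to the edges added in the extension to
    permutations, the cycle through the added edge is a loop of positive weight.
    This is [certificates].

    Given decidable membership, a subgroup of finite index is recognized by a
    finite list of words that cover all cosets without repetition
    ([computable_transversal]), and for an arbitrary subgroup the words of least
    code in their cosets represent a recursive transversal
    ([computable_transversal_decider]). A program for the latter is computed from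
    the generators by hard-wiring them into a fixed program ([computable_smn]). *)

Set Implicit Arguments.
Unset Strict Implicit.
Unset Printing Implicit Defensive.

Import Order.TTheory GRing.Theory Num.Theory intdiv.

(** * Bijective codings of structured data *)

Definition unpair n :=
  let s := CodeSeq.decode n.+1 in (head 0 s, CodeSeq.code (behead s)).

Lemma npairK a b : unpair (npair a b) = (a, b).
Proof.
rewrite /unpair -[b in npair a b]CodeSeq.decodeK -code_cons CodeSeq.codeK /=.
by rewrite CodeSeq.decodeK.
Qed.

Lemma unpairK n : npair (unpair n).1 (unpair n).2 = n.
Proof.
rewrite /unpair; have := CodeSeq.decodeK n.+1.
by case: (CodeSeq.decode n.+1) => [//|x s]; rewrite code_cons => -[].
Qed.

Lemma leq_npair a b : b <= npair a b.
Proof.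
have : b.*2.+1 <= 2 ^ a * b.*2.+1 by rewrite leq_pmull // expn_gt0.
by rewrite /npair; lia.
Qed.

(** Codings are required to be bijective: an unbounded search over numbers is
    then a search over all values of the type. *)
Class Enc (T : Type) := {
  enc : T -> nat;
  dec : nat -> T;
  encK : cancel enc dec;
  decK : cancel dec enc }.

#[export] Instance Enc_nat : Enc nat :=
  {| enc := id; dec := id; encK := fun=> erefl; decK := fun=> erefl |}.

#[export] Instance Enc_prod T U (eT : Enc T) (eU : Enc U) : Enc (T * U).
Proof.
refine {| enc := fun x => npair (enc x.1) (enc x.2);
          dec := fun n => (dec (unpair n).1, dec (unpair n).2) |}.
- by case=> x y; rewrite npairK !encK.
- by move=> n; rewrite !decK unpairK.
Defined.

#[export] Instance Enc_seq T (eT : Enc T) : Enc (seq T).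
Proof.
refine {| enc := fun s => CodeSeq.code (map enc s);
          dec := fun n => map dec (CodeSeq.decode n) |}.
- by move=> s; rewrite CodeSeq.codeK (mapK encK).
- by move=> n; rewrite (mapK decK) CodeSeq.decodeK.
Defined.

#[export] Instance Enc_option T (eT : Enc T) : Enc (option T).
Proof.
refine {| enc := fun o => if o is Some x then (enc x).+1 else 0;
          dec := fun n => if n is i.+1 then Some (dec i) else None |}.
- by case=> // x; rewrite encK.
- by case=> // n; rewrite decK.
Defined.

Lemma enc_pair T U (eT : Enc T) (eU : Enc U) (x : T) (y : U) :
  enc (x, y) = npair (enc x) (enc y).
Proof. by []. Qed.

(** The codings of lists and of options agree on this, so a list can be taken
    apart by the identity program. *)
Lemma enc_cons T (eT : Enc T) (x : T) s : enc (x :: s) = enc (Some (x, s)).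
Proof. exact: code_cons. Qed.

(** * Computable functions *)

Definition computable {T U} {eT : Enc T} {eU : Enc U} (f : T -> U) :=
  exists p, forall x, computes p (enc x) (enc (f x)).

Definition computableb {T} {eT : Enc T} (f : T -> bool) :=
  computable (fun x => nat_of_bool (f x)).

Definition id_prog := PPair PFst PSnd.

Lemma computes_id x : computes id_prog x x.
Proof.
rewrite -[X in computes _ X]unpairK -[X in computes _ _ X]unpairK.
by constructor; constructor.
Qed.

Fixpoint const_prog n :=
  if n is n'.+1 then PComp PSucc (const_prog n') else PZero.

Lemma computes_const n x : computes (const_prog n) x n.
Proof.
elim: n => [|n IH] /=; first exact: CZero.
exact: CComp IH (CSucc _).
Qed.

Section Basic.
Context {C T U V : Type} {eC : Enc C} {eT : Enc T} {eU : Enc U} {eV : Enc V}.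

Lemma eq_computable (f g : T -> U) : f =1 g -> computable f -> computable g.
Proof. by move=> fg [p pP]; exists p => x; rewrite -fg. Qed.

Lemma computable_id : computable (fun x : T => x).
Proof. by exists id_prog => x; apply: computes_id. Qed.

Lemma computable_const (u : U) : computable (fun _ : T => u).
Proof. by exists (const_prog (enc u)) => x; apply: computes_const. Qed.

Lemma computable_comp (f : T -> U) (g : C -> T) :
  computable f -> computable g -> computable (fun c => f (g c)).
Proof.
by move=> [p pP] [q qP]; exists (PComp p q) => x; apply: CComp (qP _) (pP _).
Qed.

Lemma computable_pair (f : C -> T) (g : C -> U) :
  computable f -> computable g -> computable (fun c => (f c, g c)).
Proof. by move=> [p pP] [q qP]; exists (PPair p q) => x; apply: CPair. Qed.

Lemma computable_fst (f : C -> T * U) :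
  computable f -> computable (fun c => (f c).1).
Proof.
by move=> [p pP]; exists (PComp PFst p) => x; apply: CComp (pP _) (CFst _ _).
Qed.

Lemma computable_snd (f : C -> T * U) :
  computable f -> computable (fun c => (f c).2).
Proof.
by move=> [p pP]; exists (PComp PSnd p) => x; apply: CComp (pP _) (CSnd _ _).
Qed.

Lemma computable_succ (f : C -> nat) :
  computable f -> computable (fun c => (f c).+1).
Proof.
by move=> [p pP]; exists (PComp PSucc p) => x; apply: CComp (pP _) (CSucc _).
Qed.

Lemma computable_dec : computable (dec : nat -> T).
Proof. by exists id_prog => n; rewrite decK; apply: computes_id. Qed.

Lemma computable_enc (f : C -> T) : computable f -> computable (fun c => enc (f c)).
Proof. by []. Qed.

Lemma computable_some (f : C -> T) :
  computable f -> computable (fun c => Some (f c)).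
Proof. exact: computable_succ. Qed.

End Basic.

Lemma computable_cons {C T} {eC : Enc C} {eT : Enc T} (f : C -> T) (g : C -> seq T) :
  computable f -> computable g -> computable (fun c => f c :: g c).
Proof.
move=> cf cg; have [p pP] := computable_succ (computable_enc (computable_pair cf cg)).
by exists p => c; rewrite enc_cons; apply: pP.
Qed.

Lemma computable2 {C T U V} {eC : Enc C} {eT : Enc T} {eU : Enc U} {eV : Enc V}
    (h : T -> U -> V) (f : C -> T) (g : C -> U) :
  computable (fun c => h c.1 c.2) -> computable f -> computable g ->
  computable (fun c => h (f c) (g c)).
Proof. by move=> ch cf cg; apply: (computable_comp ch (computable_pair cf cg)). Qed.

Lemma computable3 {C T U V W} {eC : Enc C} {eT : Enc T} {eU : Enc U} {eV : Enc V}
    {eW : Enc W} (h : T -> U -> V -> W) (f : C -> T) (g : C -> U) (i : C -> V) :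
  computable (fun c => h c.1 c.2.1 c.2.2) -> computable f -> computable g ->
  computable i -> computable (fun c => h (f c) (g c) (i c)).
Proof.
move=> ch cf cg ci.
exact: (computable_comp ch (computable_pair cf (computable_pair cg ci))).
Qed.

Lemma computableb2 {C T U} {eC : Enc C} {eT : Enc T} {eU : Enc U}
    (h : T -> U -> bool) (f : C -> T) (g : C -> U) :
  computableb (fun c => h c.1 c.2) -> computable f -> computable g ->
  computableb (fun c => h (f c) (g c)).
Proof. exact: (computable2 (h := fun x y => nat_of_bool (h x y))). Qed.

Section Recursion.
Context {C T U X : Type} {eC : Enc C} {eT : Enc T} {eU : Enc U} {eX : Enc X}.

Lemma computable_iteri (n : C -> nat) (h : C -> nat -> T -> T) (f : C -> T) :
  computable n -> computable (fun c => h c.1 c.2.1 c.2.2) -> computable f ->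
  computable (fun c => iteri (n c) (h c) (f c)).
Proof.
move=> [p pP] [q qP] [r rP].
exists (PComp (PRec r q) (PPair id_prog p)) => c.
apply: CComp (CPair (computes_id _) (pP c)) _ => /=.
elim: (n c) => [|i IH] /=; first exact/CRec0/rP.
exact: CRecS IH (qP (c, (i, _))).
Qed.

Lemma computable_iter (n : C -> nat) (h : C -> T -> T) (f : C -> T) :
  computable n -> computable (fun c => h c.1 c.2) -> computable f ->
  computable (fun c => iter (n c) (h c) (f c)).
Proof.
move=> cn ch cf.
apply: (@eq_computable _ _ _ _ (fun c => iteri (n c) (fun _ => h c) (f c))).
  by move=> c; elim: (n c) => //= i ->.
apply: (computable_iteri (h := fun c _ => h c)) => //.
apply: (computable2 ch).
  exact: (computable_fst computable_id).
exact: (computable_snd (computable_snd computable_id)).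
Qed.

(** Case analysis is recursion that ignores the recursive value: the code of
    [Some x] is the successor of the code of [x], and that of [None] is [0]. *)
Lemma computable_oapp (h : C -> U -> T) (f : C -> T) (o : C -> option U) :
  computable (fun c => h c.1 c.2) -> computable f -> computable o ->
  computable (fun c => oapp (h c) (f c) (o c)).
Proof.
move=> ch cf co.
apply: (@eq_computable _ _ _ _
  (fun c => iteri (enc (o c)) (fun i _ => h c (dec i)) (f c))).
  by move=> c; case: (o c) => //= x; rewrite encK.
apply: (computable_iteri (h := fun c i _ => h c (dec i))) => //.
apply: (computable2 ch).
  exact: (computable_fst computable_id).
apply: (computable_comp computable_dec).
exact: (computable_fst (computable_snd computable_id)).
Qed.

End Recursion.

Section ListRecursion.
Context {C T U X : Type} {eC : Enc C} {eT : Enc T} {eU : Enc U} {eX : Enc X}.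

Lemma computable_lcase (s : C -> seq U) (h : C -> U -> seq U -> T) (f : C -> T) :
  computable s -> computable (fun c => h c.1 c.2.1 c.2.2) -> computable f ->
  computable (fun c => if s c is x :: s' then h c x s' else f c).
Proof.
move=> [p pP] ch cf.
pose o c := if s c is x :: s' then Some (x, s') else None.
have co : computable o.
  by exists p => c; have := pP c; rewrite /o; case: (s c) => // x s'; rewrite enc_cons.
apply: (@eq_computable _ _ _ _
  (fun c => oapp (fun x => h c x.1 x.2) (f c) (o c))).
  by move=> c; rewrite /o; case: (s c).
exact: (computable_oapp (h := fun c x => h c x.1 x.2)).
Qed.

Lemma computable_if (b : C -> bool) (f g : C -> T) :
  computableb b -> computable f -> computable g ->
  computable (fun c => if b c then f c else g c).
Proof.
move=> cb cf cg.
apply: (@eq_computable _ _ _ _ (fun c => iteri (b c) (fun _ _ => f c) (g c))).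
  by move=> c; case: (b c).
apply: (computable_iteri (h := fun c _ _ => f c)) => //.
exact/(computable_comp cf)/(computable_fst computable_id).
Qed.

End ListRecursion.

Section Fold.
Context {C T X : Type} {eC : Enc C} {eT : Enc T} {eX : Enc X}.

(** A list is not longer than its code, so the code is a computable bound on
    the number of steps of a traversal; superfluous steps do nothing. *)
Lemma computable_foldl (h : C -> T -> X -> T) (f : C -> T) (s : C -> seq X) :
  computable (fun c => h c.1 c.2.1 c.2.2) -> computable f -> computable s ->
  computable (fun c => foldl (h c) (f c) (s c)).
Proof.
move=> ch cf cs.
pose step c (z : T * seq X) := if z.2 is x :: s' then (h c z.1 x, s') else z.
have stepE c n x s' : size s' <= n ->
    (iter n (step c) (x, s')).1 = foldl (h c) x s'.
  elim: n x s' => [|n IH] x [|y s'] //= le_s; last by rewrite -iterS iterSr IH.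
  by rewrite -iterS iterSr (IH _ [::]).
apply: (@eq_computable _ _ _ _
   (fun c => (iter (enc (s c)) (step c) (f c, s c)).1)).
  move=> c; apply: stepE; rewrite /= -(size_map enc).
  elim: (map enc (s c)) => // x t le_t; rewrite code_cons ltnS.
  exact: leq_trans le_t (leq_npair _ _).
apply/computable_fst/computable_iter/computable_pair => //.
apply: (computable_lcase
  (s := fun c => c.2.2) (h := fun c x s => (h c.1 c.2.1 x, s))).
- exact: (computable_snd (computable_snd computable_id)).
- apply: computable_pair; last exact: (computable_snd (computable_snd computable_id)).
  apply: (computable3 ch).
  - exact: (computable_fst (computable_fst computable_id)).
  - exact: (computable_fst (computable_snd (computable_fst computable_id))).
  - exact: (computable_fst (computable_snd computable_id)).
- exact: (computable_snd computable_id).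
Qed.
End Fold.

(** [comp] proves computability by following the syntax of the function;
    [comp_ext] is redefined whenever further operations have been treated. *)
Ltac comp_base := lazymatch goal with
  | |- computable (fun _ => ?a) => apply: computable_const
  | |- computable (fun c => c) => apply: computable_id
  | |- computable fst => exact: computable_fst computable_id
  | |- computable snd => exact: computable_snd computable_id
  | |- computable (fun c => (@?f c, @?g c)) => apply: computable_pair
  | |- computable (fun c => fst (@?f c)) => apply: computable_fst
  | |- computable (fun c => snd (@?f c)) => apply: computable_snd
  | |- computable (fun c => S (@?f c)) => apply: computable_succ
  | |- computable (fun c => @?f c :: @?g c) => apply: computable_cons
  | |- computable (fun c => Some (@?f c)) => apply: computable_some
  | |- computable (fun c => iteri (@?n c) (@?h c) (@?f c)) =>
      apply: computable_iteri
  | |- computable (fun c => iter (@?n c) (@?h c) (@?f c)) =>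
      apply: computable_iter
  | |- computable (fun c => foldl (@?h c) (@?f c) (@?s c)) =>
      apply: computable_foldl
  | |- computable (fun c => oapp (@?h c) (@?f c) (@?o c)) =>
      apply: computable_oapp
  | |- computable _ => apply: computable_if
  end.
Ltac comp_ext := fail.
Ltac comp_hyp := match goal with
  | H : computable ?g |- computable (fun c => ?g (@?f c)) =>
      apply: (computable_comp H)
  | H : computableb ?g |- computableb (fun c => ?g (@?f c)) =>
      apply: (computable_comp H)
  | H : computable (fun c => ?h (fst c) (snd c))
    |- computable (fun c => ?h (@?f c) (@?g c)) => apply: (computable2 H)
  | H : computableb (fun c => ?h (fst c) (snd c))
    |- computableb (fun c => ?h (@?f c) (@?g c)) => apply: (computableb2 H)
  | H : computable (fun c => ?h (fst c) (fst (snd c)) (snd (snd c)))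
    |- computable (fun c => ?h (@?f c) (@?g c) (@?i c)) =>
      apply: (computable3 H)
  end.
Ltac comp_step :=
  cbv beta; first [assumption | comp_ext | comp_hyp | comp_base].
Ltac comp := repeat comp_step.

Lemma computable_pred {C} {eC : Enc C} (f : C -> nat) :
  computable f -> computable (fun c => (f c).-1).
Proof.
move=> cf.
apply: (@eq_computable _ _ _ _ (fun c => iteri (f c) (fun i _ => i) 0)).
  by move=> c; case: (f c).
by comp.
Qed.

Lemma computable_sub {C} {eC : Enc C} (f g : C -> nat) :
  computable f -> computable g -> computable (fun c => f c - g c).
Proof.
move=> cf cg.
apply: (@eq_computable _ _ _ _ (fun c => iter (g c) predn (f c))).
  by move=> c; elim: (g c) => [|n /= ->] /=; lia.
by comp; apply: computable_pred; comp.
Qed.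

Lemma computable_add {C} {eC : Enc C} (f g : C -> nat) :
  computable f -> computable g -> computable (fun c => f c + g c).
Proof.
move=> cf cg.
apply: (@eq_computable _ _ _ _ (fun c => iter (g c) S (f c))).
  by move=> c; elim: (g c) => [|n /= ->] /=; lia.
by comp.
Qed.

Lemma computableb_not {C} {eC : Enc C} (a : C -> bool) :
  computableb a -> computableb (fun c => ~~ a c).
Proof.
move=> ca; apply: (@eq_computable _ _ _ _ (fun c => if a c then 0 else 1)).
  by move=> c; case: (a c).
by comp.
Qed.

Lemma computableb_and {C} {eC : Enc C} (a b : C -> bool) :
  computableb a -> computableb b -> computableb (fun c => a c && b c).
Proof.
move=> ca cb.
apply: (@eq_computable _ _ _ _ (fun c => if a c then nat_of_bool (b c) else 0)).
  by move=> c; case: (a c).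
by comp.
Qed.

Lemma computableb_or {C} {eC : Enc C} (a b : C -> bool) :
  computableb a -> computableb b -> computableb (fun c => a c || b c).
Proof.
move=> ca cb.
apply: (@eq_computable _ _ _ _ (fun c => if a c then 1 else nat_of_bool (b c))).
  by move=> c; case: (a c).
by comp.
Qed.

Lemma computableb_imply {C} {eC : Enc C} (a b : C -> bool) :
  computableb a -> computableb b -> computableb (fun c => a c ==> b c).
Proof.
move=> ca cb.
apply: (@eq_computable _ _ _ _ (fun c => if a c then nat_of_bool (b c) else 1)).
  by move=> c; case: (a c).
by comp.
Qed.

Lemma computableb_leq {C} {eC : Enc C} (f g : C -> nat) :
  computable f -> computable g -> computableb (fun c => f c <= g c).
Proof.
move=> cf cg.
apply: (@eq_computable _ _ _ _ (fun c => 1 - (f c - g c))).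
  by move=> c; case: leqP; lia.
by apply: computable_sub; [comp | apply: computable_sub].
Qed.

Lemma computableb_eqn {C} {eC : Enc C} (f g : C -> nat) :
  computable f -> computable g -> computableb (fun c => f c == g c).
Proof.
move=> cf cg; apply: (@eq_computable _ _ _ _
  (fun c => nat_of_bool ((f c <= g c) && (g c <= f c)))).
  by move=> c; rewrite eqn_leq.
by apply: computableb_and; apply: computableb_leq.
Qed.

(** The counter is reset on reaching the modulus; for modulus [0] it never is,
    which is the convention [r %% 0 = r]. *)
Lemma computable_modn {C} {eC : Enc C} (f g : C -> nat) :
  computable f -> computable g -> computable (fun c => f c %% g c).
Proof.
move=> cf cg; apply: (@eq_computable _ _ _ _
  (fun c => iter (f c) (fun r => if r.+1 == g c then 0 else r.+1) 0)).
  move=> c; elim: (f c) => [|n /= ->]; first by rewrite mod0n.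
  rewrite modnS; case: eqP => [e|ne].
    by rewrite [n in n.+1](divn_eq n (g c)) -addnS e -mulSnr dvdn_mull.
  case: ifP => // /dvdnP[k nk].
  case: (posnP (g c)) => [g0|g_gt0]; first by move: nk; rewrite g0 muln0.
  case: ne; have := ltn_pmod n g_gt0; have := divn_eq n (g c).
  move: (n %/ g c) (n %% g c) => q r nE rlt.
  have : (k - q) * g c = r.+1 by rewrite mulnBl -nk nE; lia.
  by case: (k - q) => [|[|j]]; lia.
comp; apply: computableb_eqn; comp.
Qed.

Lemma computableb_odd {C} {eC : Enc C} (f : C -> nat) :
  computable f -> computableb (fun c => odd (f c)).
Proof.
move=> cf.
apply: (@eq_computable _ _ _ _ (fun c => f c %% 2)); first by move=> c; rewrite modn2.
by apply: computable_modn; comp.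
Qed.

Lemma computableb_eq {C} {eC : Enc C} {T : eqType} {eT : Enc T} (f g : C -> T) :
  computable f -> computable g -> computableb (fun c => f c == g c).
Proof.
move=> cf cg.
apply: (@eq_computable _ _ _ _ (fun c => nat_of_bool (enc (f c) == enc (g c)))).
  by move=> c; rewrite (can_eq encK).
exact: computableb_eqn.
Qed.

Ltac comp_arith := lazymatch goal with
  | |- computable (fun c => predn (@?f c)) => apply: computable_pred
  | |- computable (fun c => @?f c - @?g c) => apply: computable_sub
  | |- computable (fun c => @?f c + @?g c) => apply: computable_add
  | |- computable (fun c => @?f c %% @?g c) => apply: computable_modn
  | |- computableb (fun _ => ?a) => apply: computable_const
  | |- computableb (fun c => ~~ @?f c) => apply: computableb_not
  | |- computableb (fun c => @?f c && @?g c) => apply: computableb_and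
  | |- computableb (fun c => @?f c || @?g c) => apply: computableb_or
  | |- computableb (fun c => @?f c ==> @?g c) => apply: computableb_imply
  | |- computableb (fun c => @?f c <= @?g c) => apply: computableb_leq
  | |- computableb (fun c => odd (@?f c)) => apply: computableb_odd
  | |- computableb (fun c => @?f c == @?g c) => apply: computableb_eq
  end.
Ltac comp_ext ::= comp_arith.

Lemma computable_rev {C T} {eC : Enc C} {eT : Enc T} (s : C -> seq T) :
  computable s -> computable (fun c => rev (s c)).
Proof.
move=> cs; apply: (@eq_computable _ _ _ _
  (fun c => foldl (fun r x => x :: r) [::] (s c))); last by comp.
move=> c; rewrite /rev; elim: (s c) [::] => //=.
Qed.

Lemma computable_foldr {C T U} {eC : Enc C} {eT : Enc T} {eU : Enc U}
    (h : C -> T -> U -> U) (f : C -> U) (s : C -> seq T) :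
  computable (fun c => h c.1 c.2.1 c.2.2) -> computable f -> computable s ->
  computable (fun c => foldr (h c) (f c) (s c)).
Proof.
move=> ch cf cs; apply: (@eq_computable _ _ _ _
  (fun c => foldl (fun y x => h c x y) (f c) (rev (s c)))).
  by move=> c; rewrite foldl_rev.
apply: (computable_foldl (h := fun c y x => h c x y)) => //.
  by comp.
exact: computable_rev.
Qed.

Lemma computable_ohead {C T} {eC : Enc C} {eT : Enc T} (s : C -> seq T) :
  computable s -> computable (fun c => ohead (s c)).
Proof. move=> cs; apply: computable_lcase; comp. Qed.

Lemma computable_behead {C T} {eC : Enc C} {eT : Enc T} (s : C -> seq T) :
  computable s -> computable (fun c => behead (s c)).
Proof. move=> cs; apply: computable_lcase; comp. Qed.

Lemma computable_cat {C T} {eC : Enc C} {eT : Enc T} (s t : C -> seq T) :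
  computable s -> computable t -> computable (fun c => s c ++ t c).
Proof.
move=> cs ct.
apply: (@eq_computable _ _ _ _ (fun c => foldr cons (t c) (s c))).
  by move=> c; elim: (s c) => //= x u ->.
by apply: computable_foldr; comp.
Qed.

Lemma computable_map {C T U} {eC : Enc C} {eT : Enc T} {eU : Enc U}
    (h : C -> T -> U) (s : C -> seq T) :
  computable (fun c => h c.1 c.2) -> computable s ->
  computable (fun c => map (h c) (s c)).
Proof.
move=> ch cs.
apply: (@eq_computable _ _ _ _
  (fun c => foldr (fun x t => h c x :: t) [::] (s c))) => //.
by apply: computable_foldr; comp.
Qed.

Lemma computable_filter {C T} {eC : Enc C} {eT : Enc T}
    (h : C -> T -> bool) (s : C -> seq T) :
  computableb (fun c => h c.1 c.2) -> computable s ->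
  computable (fun c => filter (h c) (s c)).
Proof.
move=> ch cs.
apply: (@eq_computable _ _ _ _
  (fun c => foldr (fun x t => if h c x then x :: t else t) [::] (s c))) => //.
by apply: computable_foldr; comp.
Qed.

Lemma computableb_all {C T} {eC : Enc C} {eT : Enc T}
    (h : C -> T -> bool) (s : C -> seq T) :
  computableb (fun c => h c.1 c.2) -> computable s ->
  computableb (fun c => all (h c) (s c)).
Proof.
move=> ch cs.
apply: (@eq_computable _ _ _ _
  (fun c => foldr (fun x r => if h c x then r else 0) 1 (s c))).
  by move=> c; elim: (s c) => //= x t ->; case: (h c x).
by apply: computable_foldr; comp.
Qed.

Lemma computableb_has {C T} {eC : Enc C} {eT : Enc T}
    (h : C -> T -> bool) (s : C -> seq T) :
  computableb (fun c => h c.1 c.2) -> computable s ->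
  computableb (fun c => has (h c) (s c)).
Proof.
move=> ch cs.
apply: (@eq_computable _ _ _ _
  (fun c => foldr (fun x r => if h c x then 1 else r) 0 (s c))).
  by move=> c; elim: (s c) => //= x t ->; case: (h c x).
by apply: computable_foldr; comp.
Qed.

Lemma computableb_mem {C} {T : eqType} {eC : Enc C} {eT : Enc T}
    (f : C -> T) (s : C -> seq T) :
  computable f -> computable s -> computableb (fun c => f c \in s c).
Proof.
move=> cf cs.
apply: (@eq_computable _ _ _ _ (fun c => nat_of_bool (has (fun x => f c == x) (s c)))).
  move=> c; rewrite -has_pred1; congr nat_of_bool.
  by apply: eq_has => x; apply: eq_sym.
by apply: computableb_has; comp.
Qed.

Lemma computable_count_mem {C} {T : eqType} {eC : Enc C} {eT : Enc T}
    (f : C -> T) (s : C -> seq T) :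
  computable f -> computable s -> computable (fun c => count_mem (f c) (s c)).
Proof.
move=> cf cs.
apply: (@eq_computable _ _ _ _
  (fun c => foldr (fun x r => if x == f c then r.+1 else r) 0 (s c))).
  by move=> c; elim: (s c) => //= x t ->; case: eqP.
by apply: computable_foldr; comp.
Qed.

Lemma computable_flatten {C T} {eC : Enc C} {eT : Enc T} (s : C -> seq (seq T)) :
  computable s -> computable (fun c => flatten (s c)).
Proof. by move=> cs; apply: computable_foldr; comp; apply: computable_cat; comp. Qed.

Lemma computable_size {C T} {eC : Enc C} {eT : Enc T} (s : C -> seq T) :
  computable s -> computable (fun c => size (s c)).
Proof.
move=> cs; apply: (@eq_computable _ _ _ _ (fun c => foldr (fun _ n => n.+1) 0 (s c))).
  by move=> c; elim: (s c) => //= x t ->.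
by apply: computable_foldr; comp.
Qed.

Lemma computable_nth {C T} {eC : Enc C} {eT : Enc T} (x0 : T)
    (s : C -> seq T) (n : C -> nat) :
  computable s -> computable n -> computable (fun c => nth x0 (s c) (n c)).
Proof.
move=> cs cn; apply: (@eq_computable _ _ _ _
  (fun c => oapp id x0 (ohead (iter (n c) behead (s c))))).
  move=> c; elim: (n c) (s c) => [|i IH] [|x t] //; rewrite iterSr IH //=.
  by rewrite nth_nil.
by comp; [apply: computable_ohead; comp; apply: computable_behead; comp].
Qed.

Lemma computableb_all_iota {C} {eC : Enc C} (h : C -> nat -> bool) (m n : C -> nat) :
  computableb (fun c => h c.1 c.2) -> computable m -> computable n ->
  computableb (fun c => all (h c) (iota (m c) (n c))).
Proof.
move=> ch cm cn; apply: (@eq_computable _ _ _ _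
  (fun c => iteri (n c) (fun i r => if h c (m c + i) then r else 0) 1)).
  move=> c; elim: (n c) => // i IH.
  rewrite -[in RHS]addn1 iotaD all_cat /= IH andbT andbC.
  by case: (h c _).
by comp.
Qed.

Ltac comp_seq := lazymatch goal with
  | |- computable (fun c => rev (@?s c)) => apply: computable_rev
  | |- computable (fun c => @?s c ++ @?t c) => apply: computable_cat
  | |- computable (fun c => map (@?h c) (@?s c)) => apply: computable_map
  | |- computable (fun c => filter (@?h c) (@?s c)) => apply: computable_filter
  | |- computable (fun c => flatten (@?s c)) => apply: computable_flatten
  | |- computable (fun c => size (@?s c)) => apply: computable_size
  | |- computable (fun c => nth ?x (@?s c) (@?n c)) => apply: computable_nth
  | |- computable (fun c => foldr (@?h c) (@?f c) (@?s c)) =>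
      apply: computable_foldr
  | |- computable (fun c => count_mem (@?f c) (@?s c)) =>
      apply: computable_count_mem
  | |- computableb (fun c => all (@?h c) (iota (@?m c) (@?n c))) =>
      apply: computableb_all_iota
  | |- computableb (fun c => all (@?h c) (@?s c)) => apply: computableb_all
  | |- computableb (fun c => has (@?h c) (@?s c)) => apply: computableb_has
  | |- computableb (fun c => @?f c \in @?s c) => apply: computableb_mem
  end.
Ltac comp_ext ::= first [comp_arith | comp_seq].

(** Unbounded search. Minimality of the answer is recorded because it makes the
    answer depend only on the set of solutions, not on the parameter. *)
Lemma computable_search {C X} {eC : Enc C} {eX : Enc X} (P : C -> X -> bool) :
  (forall c, exists x, P c x) -> computableb (fun c => P c.1 c.2) ->
  exists f : C -> X, [/\ computable f, forall c, P c (f c) &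
    forall c x, P c x -> enc (f c) <= enc x].
Proof.
move=> P_ex cP; have P_exn c : exists n, P c (dec n).
  by have [x Px] := P_ex c; exists (enc x); rewrite encK.
exists (fun c => dec (ex_minn (P_exn c))); split=> [|c|c x Px].
- have [p pP] : computableb (fun c => ~~ P c.1 c.2) by comp.
  exists (PMu p) => c; rewrite decK; case: ex_minnP => n Pn n_min.
  apply: (@CMu _ _ _ (fun=> 0)) => [i i_lt|].
    have := pP (c, @dec X eX i); rewrite enc_pair decK /=.
    by case Pi: (P c (dec i)) => //; move: i_lt; rewrite ltnNge n_min.
  by have := pP (c, @dec X eX n); rewrite enc_pair decK /= Pn.
- by case: ex_minnP.
- by rewrite decK; case: ex_minnP => n _; apply; rewrite encK.
Qed.

Lemma code_program_const n :
  code_program (const_prog n)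
    = iter n (fun i => npair 5 (npair (code_program PSucc) i)) (code_program PZero).
Proof. by elim: n => //= n ->. Qed.

Lemma computable_npair {C} {eC : Enc C} (f g : C -> nat) :
  computable f -> computable g -> computable (fun c => npair (f c) (g c)).
Proof. by move=> [p pP] [q qP]; exists (PPair p q) => c; apply: CPair. Qed.

(** The parameter [c] is hard-wired by composition with a constant program, and
    the Goedel number of a constant program is computed from the constant by
    iteration. *)
Lemma computable_smn {C X} {eC : Enc C} {eX : Enc X} (D : C -> X -> bool) :
  computableb (fun c => D c.1 c.2) ->
  exists r : C -> program, computable (fun c => code_program (r c)) /\
    forall c x, computes (r c) (enc x) (D c x).
Proof.
move=> [p pP].
exists (fun c => PComp p (PPair (const_prog (enc c)) id_prog)); split.
  rewrite /=; apply: (@eq_computable _ _ _ _ (fun c => npair 5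
   (npair (code_program p) (npair 4 (npair
     (iter (enc c) (fun i => npair 5 (npair (code_program PSucc) i))
       (code_program PZero)) (code_program id_prog)))))).
    by move=> c; rewrite -code_program_const.
  have cenc : computable (fun c : C => enc c) by exact: computable_id.
  move: (code_program PSucc) (code_program PZero) => u v.
  move: (code_program p) (code_program id_prog) => i j.
  do !(apply: computable_npair || comp_step).
move=> c x; apply: CComp (pP (c, x)).
exact: CPair (computes_const _ _) (computes_id _).
Qed.

Import Order.TTheory GRing.Theory Num.Theory intdiv.

(** * Words and their triviality *)

(** Words are lists of arbitrary numbers. The generator of index [i] is the
    letter [2 * i] and its inverse is [2 * i + 1]; letters beyond the last
    generator act trivially, which makes the algorithms total on lists of
    numbers. *)
Definition linv l := if odd l then l.-1 else l.+1.
Definition winv w := rev (map linv w).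

Lemma odd_linv l : odd (linv l) = ~~ odd l.
Proof. by case: l => // l; rewrite /linv /=; case ol: (odd l); rewrite /= ?ol. Qed.

Lemma linvK : involutive linv.
Proof.
move=> l; rewrite {1}/linv odd_linv /linv; case: l => //= l.
by case ol: (odd l); rewrite /= ?ol.
Qed.

Lemma linv_neq l : (linv l == l) = false.
Proof. by rewrite /linv; case: ifP; lia. Qed.

Lemma linv_ltn l j : (linv l < j.*2) = (l < j.*2).
Proof. by rewrite /linv; case: ifP; lia. Qed.

Lemma leq_linv l j : (j.*2 <= linv l) = (j.*2 <= l).
Proof. by rewrite leqNgt linv_ltn -leqNgt. Qed.

Lemma half_linv l : (linv l)./2 = l./2.
Proof. by rewrite /linv; case: ifP; lia. Qed.

Lemma winvK : involutive winv.
Proof. by move=> w; rewrite /winv map_rev revK mapK //; exact: linvK. Qed.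

Lemma count_winv l w : count_mem l (winv w) = count_mem (linv l) w.
Proof.
rewrite /winv count_rev count_map; apply: eq_count => x /=.
by rewrite (can2_eq linvK linvK).
Qed.

Lemma winv_cat u w : winv (u ++ w) = winv w ++ winv u.
Proof. by rewrite /winv map_cat rev_cat. Qed.

Definition run T (act : nat -> T -> T) (x : T) (w : seq nat) :=
  foldl (fun x l => act l x) x w.

Lemma run_cat T (act : nat -> T -> T) x u w :
  run act x (u ++ w) = run act (run act x u) w.
Proof. exact: foldl_cat. Qed.

Definition rpush l w :=
  if w is l' :: w' then if l' == linv l then w' else l :: w else [:: l].
Definition freduce w := foldr rpush [::] w.

Section Words.
Variables n m : nat.

(** The letters below [n.*2] belong to the free factor, the next [m.*2] ones to
    the central factor. *)
Definition fpart w := [seq l <- w | l < n.*2].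
Definition balanced w :=
  all (fun l => count_mem l w == count_mem (linv l) w) (iota n.*2 m.*2).
(** The word problem of [F_n * Z^m]. *)
Definition trivial_word w := (freduce (fpart w) == [::]) && balanced w.

(** An action of the letters satisfying the defining relations of [F_n * Z^m].
    It will be instantiated by right multiplication in a group and by the
    weighted permutations that serve as certificates. *)
Section Action.
Variables (T : Type) (D : T -> Prop) (act : nat -> T -> T).
Hypothesis actD : forall l x, D x -> D (act l x).
Hypothesis actK : forall l x, D x -> act (linv l) (act l x) = x.
Hypothesis actC : forall l l' x, n.*2 <= l -> D x ->
  act l (act l' x) = act l' (act l x).
Hypothesis act_id : forall l x, (n + m).*2 <= l -> act l x = x.

Lemma runD w x : D x -> D (run act x w).
Proof. by elim: w x => //= l w IH x Dx; apply/IH/actD. Qed.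

Lemma run_winv w x : D x -> run act (run act x w) (winv w) = x.
Proof.
elim: w x => //= l w IH x Dx.
rewrite -cat1s winv_cat run_cat IH; last exact: actD.
exact: actK.
Qed.

Lemma run_inj w x y : D x -> D y -> run act x w = run act y w -> x = y.
Proof. by move=> Dx Dy e; rewrite -(run_winv w Dx) e run_winv. Qed.

Lemma run_freduce w x : D x -> run act x (freduce w) = run act x w.
Proof.
elim: w x => //= l w IH x Dx; rewrite -IH; last exact: actD.
case: (freduce w) => [//|l' w'] /=; case: eqP => [->|//].
by rewrite actK.
Qed.

Definition cpart w := [seq l <- w | n.*2 <= l < (n + m).*2].

Lemma run_central w l x : all (leq n.*2) w -> D x ->
  run act (act l x) w = act l (run act x w).
Proof.
elim: w x => //= l' w IH x /andP[le_l' w_c] Dx.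
by rewrite actC // IH //; apply: actD.
Qed.

Lemma run_split w x : D x -> run act x w = run act (run act x (cpart w)) (fpart w).
Proof.
elim: w x => //= l w IH x Dx; rewrite IH; last exact: actD.
case: (ltnP l n.*2) => /= [lt_l|le_l].
  rewrite -run_central //; apply/allP => l'.
  by rewrite mem_filter => /andP[/andP[]].
by case: ltnP => // le2_l; rewrite act_id.
Qed.

Lemma run_rem w l x : n.*2 <= l -> l \in w -> D x ->
  run act x w = run act (act l x) (rem l w).
Proof.
move=> le_l; elim: w x => //= l' w IH x; rewrite inE.
case: (eqVneq l' l) => [->|ne] /= => [_ _ //|l_w Dx].
by rewrite IH //; [rewrite (actC l' le_l Dx) | apply: actD].
Qed.

(** Induction on the length: balance provides an occurrence of the inverse of
    the first letter, and centrality allows the two to be cancelled. *)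
Lemma run_balanced w x : all (leq n.*2) w ->
  (forall l, count_mem l w = count_mem (linv l) w) -> D x -> run act x w = x.
Proof.
have [j] := ubnP (size w); elim: j w x => // j IH [//|l w] x /= lt_j.
move=> /andP[le_l w_c] bal Dx.
have l'_w : linv l \in w.
  have := bal (linv l); rewrite linvK eqxx [l == _]eq_sym linv_neq /= add0n.
  by rewrite -has_pred1 has_count => ->.
rewrite (run_rem _ l'_w (actD l Dx)); last exact: (allP w_c).
rewrite actK //; apply: IH => //.
- rewrite size_rem //; move: lt_j; rewrite ltnS; exact: leq_ltn_trans (leq_pred _).
- by apply/allP => y /mem_rem; apply: (allP w_c).
move=> y; have := bal y; rewrite !(seq.permP (perm_to_rem l'_w)) /=.
by rewrite !(can2_eq linvK linvK) linvK; lia.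
Qed.

Lemma count_cpart l w :
  count_mem l (cpart w) = if n.*2 <= l < (n + m).*2 then count_mem l w else 0.
Proof.
rewrite count_filter; case: ifP => l_c.
  by apply: eq_count => y /=; case: eqP => // ->.
rewrite -(count_pred0 w); apply: eq_count => y /=; case: eqP => // ->.
by rewrite l_c.
Qed.

Lemma run_trivial w x : trivial_word w -> D x -> run act x w = x.
Proof.
move=> /andP[/eqP red_w bal_w] Dx; rewrite run_split // (@run_balanced (cpart w)) //.
- by rewrite -run_freduce // red_w.
- by apply/allP => l'; rewrite mem_filter => /andP[/andP[]].
move=> l; rewrite !count_cpart (leq_linv l) (linv_ltn l).
case: ifP => // l_c; apply/eqP; move/allP: bal_w; apply.
by rewrite mem_iota -doubleD.
Qed.
End Action.

(** * Certificates *)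

(** A certificate [(d, (N, table))] encodes an action of the generators on
    [Z/N]-labelled points: the vertices are the numbers below [d], and the letter
    [l] sends [(v, z)] to [(v', z + p - q)] where [(v', (p, q))] is the entry of
    the table at [l] and [v]. Integers are differences of naturals, and the
    modulus [0] stands for the group [Z]. *)
Definition cert : Type := nat * (nat * seq (seq (nat * (nat * nat)))).

Definition edge (c : cert) l v := nth (0, (0, 0)) (nth [::] c.2.2 l) v.

(** The letter [linv l] undoes [l], and central letters act by translations that
    do not depend on the vertex. *)
Definition edge_ok (c : cert) l v :=
  [&& (edge c l v).1 < c.1,
      (edge c (linv l) (edge c l v).1).1 == v,
      ((edge c l v).2.1 + (edge c (linv l) (edge c l v).1).2.1) %% c.2.1
       == ((edge c l v).2.2 + (edge c (linv l) (edge c l v).1).2.2) %% c.2.1 &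
      (n.*2 <= l) ==> (edge c l v == (v, (edge c l 0).2))].

Definition good_cert (c : cert) :=
  (0 < c.1) &&
  all (fun l => all (edge_ok c l) (iota 0 c.1)) (iota 0 (n + m).*2).

Definition cstep (c : cert) (st : nat * (nat * nat)) l :=
  if l < (n + m).*2 then
    ((edge c l st.1).1,
     (st.2.1 + (edge c l st.1).2.1, st.2.2 + (edge c l st.1).2.2))
  else st.

Definition crun (c : cert) w := foldl (cstep c) (0, (0, 0)) w.

Definition cfix (c : cert) w :=
  ((crun c w).1 == 0) && ((crun c w).2.1 %% c.2.1 == (crun c w).2.2 %% c.2.1).

Section Semantics.
Variable c : cert.
Local Open Scope ring_scope.

(** Computations keep unreduced pairs of naturals; [cact] is the action they
    represent. *)
Definition modc (z : int) : int := (z %% (c.2.1%:Z))%Z.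

Definition sem (st : nat * (nat * nat)) : nat * int :=
  (st.1, modc (st.2.1%:Z - st.2.2%:Z)).

Definition cact l (x : nat * int) : nat * int :=
  if (l < (n + m).*2)%N then
    ((edge c l x.1).1, modc (x.2 + (edge c l x.1).2.1%:Z - (edge c l x.1).2.2%:Z))
  else x.

Lemma modcDl y z : modc (modc y + z) = modc (y + z).
Proof. by rewrite /modc modzDml. Qed.

Lemma modc_id z : modc (modc z) = modc z.
Proof. by rewrite /modc modz_mod. Qed.

Lemma modc_eq0 p q : (modc (p%:Z - q%:Z) == 0) = (p %% c.2.1 == q %% c.2.1)%N.
Proof.
rewrite /modc (sameP eqP dvdz_mod0P) -eqz_mod_dvd.
by rewrite !modz_nat eqz_nat.
Qed.

Lemma sem_cstep st l : sem (cstep c st l) = cact l (sem st).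
Proof.
rewrite /cact /cstep /sem; case: ifP => //= _; congr (_, _).
by rewrite -addrA modcDl !PoszD; congr modc; rewrite opprD addrACA addrA.
Qed.

Lemma sem_crun w : sem (crun c w) = run cact (0, 0) w.
Proof.
rewrite /crun /run.
have -> : (0, 0) = sem (0, (0, 0)) by rewrite /sem /= subrr /modc mod0z.
by elim: w (0, (0, 0)) => //= l w IH st; rewrite IH sem_cstep.
Qed.

Lemma cfixP w : reflect (run cact (0, 0) w = (0, 0)) (cfix c w).
Proof.
rewrite -sem_crun /cfix -modc_eq0 /sem.
by apply: (iffP andP) => [[/eqP-> /eqP->]|[-> ->]].
Qed.

Hypothesis good_c : good_cert c.

Definition cdom (x : nat * int) := (x.1 < c.1)%N /\ modc x.2 = x.2.

Lemma cdom0 : cdom (0, 0).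
Proof. by case/andP: good_c => c0 _; split; rewrite // /modc mod0z. Qed.

Lemma edgeP l v : (l < (n + m).*2)%N -> (v < c.1)%N -> edge_ok c l v.
Proof.
case/andP: good_c => _ ok lt_l lt_v.
by apply: (allP (allP ok l _)); rewrite mem_iota.
Qed.

Lemma cactD l x : cdom x -> cdom (cact l x).
Proof.
move=> [xd xN]; rewrite /cact; case: ifP => // lt_l.
by case/and4P: (edgeP lt_l xd) => *; split; rewrite //= modc_id.
Qed.

Lemma cactK l x : cdom x -> cact (linv l) (cact l x) = x.
Proof.
case: x => v z [/= xd xN]; rewrite /cact linv_ltn; case lt_l: (l < _)%N => //=.
case/and4P: (edgeP lt_l xd) => _ /eqP-> e _; congr (_, _).
move: e; rewrite -modc_eq0 => /eqP e.
rewrite -addrA modcDl -[RHS]xN -[z in RHS]add0r -e modcDl; congr modc.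
by rewrite !PoszD; ring.
Qed.

Lemma cactC l l' x : (n.*2 <= l)%N -> cdom x ->
  cact l (cact l' x) = cact l' (cact l x).
Proof.
case: x => v z le_l [/= xd xN]; rewrite /cact.
case lt_l': (l' < _)%N; case lt_l: (l < _)%N; rewrite ?lt_l' ?lt_l //=.
case/and4P: (edgeP lt_l xd) => _ _ _; rewrite le_l => /eqP-> /=.
case/and4P: (edgeP lt_l' xd) => v'd _ _ _.
case/and4P: (edgeP lt_l v'd) => _ _ _; rewrite le_l => /eqP-> /=.
congr (_, _); rewrite -!(addrA (modc _)) !modcDl; congr modc; ring.
Qed.

Lemma cact_id l x : ((n + m).*2 <= l)%N -> cact l x = x.
Proof. by rewrite /cact ltnNge => ->. Qed.

Lemma crun_trivial w x : trivial_word w -> cdom x -> run cact x w = x.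
Proof. exact: (run_trivial cactD cactK cactC cact_id). Qed.

Lemma crun_winv w x : cdom x -> run cact (run cact x w) (winv w) = x.
Proof. exact: (run_winv cactD cactK). Qed.

Lemma crun_inj w x y : cdom x -> cdom y -> run cact x w = run cact y w -> x = y.
Proof. exact: (run_inj cactD cactK). Qed.

Lemma cdom_run w x : cdom x -> cdom (run cact x w).
Proof. exact: (runD cactD). Qed.

End Semantics.

(** For modulus [0] the action commutes with the translations of the labels. *)
Lemma cact_shift (c : cert) l v (z t : int) : c.2.1 = 0 ->
  cact c l (v, z + t)%R = ((cact c l (v, z)).1, (cact c l (v, z)).2 + t)%R.
Proof.
move=> N0; rewrite /cact; case: ifP => //= _.
by rewrite /modc N0 !modz0; congr (_, _); ring.
Qed.

Lemma run_shift (c : cert) w v (z t : int) : c.2.1 = 0 ->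
  run (cact c) (v, z + t)%R w
    = ((run (cact c) (v, z) w).1, (run (cact c) (v, z) w).2 + t)%R.
Proof.
move=> N0; elim: w v z => //= l w IH v z.
by rewrite cact_shift // IH; case: (cact c l _).
Qed.

(** The inverse of [w] is, in [F_n * Z^m], the product of the words [us] taken
    from [S] and their inverses. *)
Definition pos_cert (S : seq (seq nat)) w (us : seq (seq nat)) :=
  all (fun u => (u \in S) || (winv u \in S)) us && trivial_word (w ++ flatten us).

(** The stabilizer of the base point contains [S] but not [w]. *)
Definition neg_cert (S : seq (seq nat)) w (c : cert) :=
  [&& good_cert c, all (cfix c) S & ~~ cfix c w].

(** The stabilizer of the base point contains [S], and with [x.2 = (u, y)] the
    word [y] is a loop of nonzero integral weight at the vertex reached by [u]. *)
Definition inf_cert (S : seq (seq nat)) (x : cert * (seq nat * seq nat)) :=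
  [&& good_cert x.1, x.1.2.1 == 0, all (cfix x.1) S,
   (crun x.1 x.2.1).1 == (crun x.1 (x.2.1 ++ x.2.2)).1 &
   (crun x.1 x.2.1).2.1 + (crun x.1 (x.2.1 ++ x.2.2)).2.2 !=
   (crun x.1 x.2.1).2.2 + (crun x.1 (x.2.1 ++ x.2.2)).2.1].

(** This makes positive and negative certificates for the same word exclude each
    other. *)
Lemma pos_cert_run (S : seq (seq nat)) w us c : good_cert c -> all (cfix c) S ->
  pos_cert S w us -> run (cact c) (0, 0%R) w = (0, 0%R).
Proof.
move=> gc fixS /andP[us_S tw]; have d0 := cdom0 gc.
have fix_us : run (cact c) (0, 0%R) (flatten us) = (0, 0%R).
  elim: us us_S {tw} => //= u us IH /andP[u_S /IH {}IH].
  rewrite run_cat -[RHS]IH; congr run.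
  case/orP: u_S => [/(allP fixS)/cfixP->//|/(allP fixS)/cfixP e].
  by rewrite -[u in LHS]winvK -[in LHS]e crun_winv.
apply: (crun_inj gc (w := flatten us)) => //; first exact: cdom_run.
by rewrite -run_cat (crun_trivial gc tw d0) fix_us.
Qed.

Lemma neg_certP (S : seq (seq nat)) w us c : pos_cert S w us -> ~~ neg_cert S w c.
Proof.
move=> pos; apply/negP => /and3P[gc fixS /negP]; apply.
exact/cfixP/(pos_cert_run gc fixS pos).
Qed.

(** Each turn around the loop [y] changes the label by the same nonzero amount,
    so the words [u y^i] lie in distinct cosets of the stabilizer. *)
Lemma inf_certP (S : seq (seq nat)) c u y : inf_cert S (c, (u, y)) ->
  forall i j us,
    pos_cert S ((u ++ flatten (nseq i y)) ++ winv (u ++ flatten (nseq j y))) us ->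
  i = j.
Proof.
case/and5P=> /= gc /eqP N0 fixS /eqP v_eq w_ne i j us pos.
have d0 := cdom0 gc.
have run_u : run (cact c) (0, 0%R) u = sem c (crun c u) by rewrite sem_crun.
have run_uy : run (cact c) (0, 0%R) (u ++ y) = sem c (crun c (u ++ y)).
  by rewrite sem_crun.
pose z0 := ((crun c u).2.1%:Z - (crun c u).2.2%:Z)%R.
pose delta := ((crun c (u ++ y)).2.1%:Z - (crun c (u ++ y)).2.2%:Z - z0)%R.
rewrite /sem /modc N0 !modz0 -v_eq in run_u run_uy.
have run_y t : run (cact c) ((crun c u).1, z0 + t)%R y
    = ((crun c u).1, z0 + t + delta)%R.
  by rewrite run_shift // -run_u -run_cat run_uy /= /delta; congr (_, _); ring.
have run_uyi t : run (cact c) (0, 0%R) (u ++ flatten (nseq t y))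
    = ((crun c u).1, z0 + t%:Z * delta)%R.
  rewrite run_cat run_u -/z0.
  have : forall r, run (cact c) ((crun c u).1, z0 + r)%R (flatten (nseq t y))
      = ((crun c u).1, z0 + r + t%:Z * delta)%R.
    elim: t => [|t IH] r /=; first by rewrite mul0r addr0.
    by rewrite run_cat run_y -addrA IH; congr (_, _); rewrite -addn1 PoszD; ring.
  by move=> /(_ 0%R); rewrite addr0.
have := pos_cert_run gc fixS pos.
rewrite run_cat -[X in _ = X](crun_winv gc (u ++ flatten (nseq j y)) d0).
move/(crun_inj gc (cdom_run gc _ d0) (cdom_run gc _ d0)).
rewrite !run_uyi => -[/addrI/mulIf e]; suff /e[//] : delta != 0%R.
rewrite subr_eq0; move: w_ne; rewrite /z0; lia.
Qed.

End Words.

(** * Computability of the certificate checks *)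

Lemma computable_linv {C} {eC : Enc C} (f : C -> nat) :
  computable f -> computable (fun c => linv (f c)).
Proof. by move=> cf; rewrite /linv; comp. Qed.

Ltac comp_linv := lazymatch goal with
  | |- computable (fun c => linv (@?f c)) => apply: computable_linv
  end.
Ltac comp_ext ::= first [comp_arith | comp_seq | comp_linv].

Section ComputableWords.
Context {C : Type} {eC : Enc C}.

Lemma computable_winv (f : C -> seq nat) :
  computable f -> computable (fun c => winv (f c)).
Proof. by move=> cf; rewrite /winv; comp. Qed.

Lemma computable_rpush (l : C -> nat) (w : C -> seq nat) :
  computable l -> computable w -> computable (fun c => rpush (l c) (w c)).
Proof.
move=> cl cw; rewrite /rpush.
apply: (computable_lcase
  (h := fun c l' w' => if l' == linv (l c) then w' else l c :: w c)); comp.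
Qed.

Lemma computable_edge (c : C -> cert) (l v : C -> nat) :
  computable c -> computable l -> computable v ->
  computable (fun x => edge (c x) (l x) (v x)).
Proof. by move=> cc cl cv; rewrite /edge; comp. Qed.
End ComputableWords.

Ltac comp_word := lazymatch goal with
  | |- computable (fun c => linv (@?f c)) => apply: computable_linv
  | |- computable (fun c => winv (@?f c)) => apply: computable_winv
  | |- computable (fun c => rpush (@?f c) (@?g c)) => apply: computable_rpush
  | |- computable (fun c => edge (@?f c) (@?g c) (@?h c)) => apply: computable_edge
  end.
Ltac comp_ext ::= first [comp_arith | comp_seq | comp_word].

Section ComputableCertificates.
Context {C : Type} {eC : Enc C}.
Variables n m : nat.

Lemma computableb_trivial_word (w : C -> seq nat) :
  computable w -> computableb (fun c => trivial_word n m (w c)).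
Proof. by move=> cw; rewrite /trivial_word /freduce /fpart /balanced; comp. Qed.

Lemma computableb_edge_ok (c : C -> cert) (l v : C -> nat) :
  computable c -> computable l -> computable v ->
  computableb (fun x => edge_ok n (c x) (l x) (v x)).
Proof. by move=> cc cl cv; rewrite /edge_ok; comp. Qed.
End ComputableCertificates.

Lemma computableb_good_cert {C} {eC : Enc C} n m (c : C -> cert) :
  computable c -> computableb (fun x => good_cert n m (c x)).
Proof.
move=> cc; rewrite /good_cert; comp.
by apply: computableb_edge_ok; comp.
Qed.

Lemma computable_crun {C} {eC : Enc C} n m (c : C -> cert) (w : C -> seq nat) :
  computable c -> computable w -> computable (fun x => crun n m (c x) (w x)).
Proof. by move=> cc cw; rewrite /crun /cstep; comp. Qed.

Ltac comp_cert := lazymatch goal with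
  | |- computableb (fun c => trivial_word _ _ (@?w c)) =>
      apply: computableb_trivial_word
  | |- computableb (fun c => good_cert _ _ (@?f c)) => apply: computableb_good_cert
  | |- computable (fun c => crun _ _ (@?f c) (@?g c)) => apply: computable_crun
  end.
Ltac comp_ext ::= first [comp_arith | comp_seq | comp_word | comp_cert].

Section ComputableChecks.
Context {C : Type} {eC : Enc C}.
Variables n m : nat.

Lemma computableb_pos_cert (S : C -> seq (seq nat)) w us :
  computable S -> computable w -> computable us ->
  computableb (fun x => pos_cert n m (S x) (w x) (us x)).
Proof. by move=> cS cw cus; rewrite /pos_cert; comp. Qed.

Lemma computableb_neg_cert (S : C -> seq (seq nat)) w c :
  computable S -> computable w -> computable c ->
  computableb (fun x => neg_cert n m (S x) (w x) (c x)).
Proof. by move=> cS cw cc; rewrite /neg_cert /cfix; comp. Qed.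

Lemma computableb_inf_cert (S : C -> seq (seq nat)) c :
  computable S -> computable c -> computableb (fun x => inf_cert n m (S x) (c x)).
Proof. by move=> cS cc; rewrite /inf_cert /cfix; comp. Qed.
End ComputableChecks.

(** * Finite pieces of Schreier graphs as certificates *)

Lemma extend_perm (T : finType) (D : {set T}) (f : T -> T) :
  {in D &, injective f} -> exists s : {perm T}, {in D, s =1 f}.
Proof.
have [j] := ubnP #|~: D|; elim: j D f => // j IH D f lt_j f_inj.
have [D0|[x]] := set_0Vmem (~: D).
  have DT x : x \in D by rewrite -[D]finset.setCK D0 finset.setC0 inE.
  have fI : injective f by move=> x y; apply: f_inj.
  by exists (perm fI) => x _; rewrite permE.
rewrite inE => xD.
have [y yD] : exists y, y \notin f @: D.
  apply/existsP; rewrite -negb_forall; apply/negP => /forallP fD.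
  have : #|D| < #|T|.
    rewrite -cardsT proper_card // properT.
    by apply: contra xD => /eqP->; rewrite inE.
  rewrite ltnNge => /negP; apply.
  have fT : f @: D = [set: T]%SET by apply/setP => y; rewrite fD inE.
  by rewrite -cardsT -fT leq_imset_card.
have fy z : z \in D -> (f z == y) = false.
  by move=> zD; apply: contraNF yD => /eqP<-; apply: imset_f.
have [] := IH (x |: D)%SET (fun z => if z == x then y else f z).
- have -> : ~: (x |: D) = (~: D) :\ x.
    by apply/setP => z; rewrite !inE negb_or.
  by move: lt_j; rewrite (cardsD1 x) inE xD add1n ltnS.
- move=> a b; rewrite !inE.
  case: eqVneq => [->|ax] /= aD; case: eqVneq => [->|bx] //= bD.
  + by move/eqP; rewrite eq_sym fy.
  + by move/eqP; rewrite fy.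
  + exact: f_inj.
move=> s sE; exists s => z zD; rewrite sE ?inE ?zD ?orbT //.
by case: eqP => // zx; move: xD; rewrite -zx zD.
Qed.

Definition zpair (z : int) : nat * nat :=
  match z with Posz p => (p, 0) | Negz q => (0, q.+1) end.

Lemma zpairK z : ((zpair z).1%:Z - (zpair z).2%:Z)%R = z.
Proof. by case: z => p /=; lia. Qed.

Lemma zpairN z :
  (zpair (- z)%R).1 + (zpair z).1 = (zpair (- z)%R).2 + (zpair z).2.
Proof. by case: z => [[|p]|q] //=; rewrite addn0. Qed.

Section Subgroups.
Local Open Scope group_scope.
Variables (G : groupType) (K : set G).
Hypothesis subK : is_subgroup K.

Lemma subgroup1 : K 1. Proof. by case: subK. Qed.

Lemma subgroupV x : K x -> K x^-1.
Proof. by case: subK => K1 KB Kx; rewrite -[x^-1]mul1g; apply: KB. Qed.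

Lemma subgroupM x y : K x -> K y -> K (x * y).
Proof.
by case: subK => _ KB Kx Ky; rewrite -[y]invgK; apply: KB Kx (subgroupV Ky).
Qed.

Lemma subgroupVM x y : K (x * y^-1) -> K (y * x^-1).
Proof. by move=> Kxy; rewrite -[_ * _]invgK invMg invgK; apply: subgroupV. Qed.
End Subgroups.

Section Evaluation.
Local Open Scope group_scope.
Variables (G : groupType) (gen : nat -> G).

Definition lval l : G := if odd l then (gen l./2)^-1 else gen l./2.
Definition eval (w : seq nat) : G := run (fun l x => x * lval l) 1 w.

Lemma eval_rcons w l : eval (rcons w l) = eval w * lval l.
Proof. by rewrite /eval /run foldl_rcons. Qed.

Lemma eval_run x w : run (fun l x => x * lval l) x w = x * eval w.
Proof.
elim/last_ind: w => [|w l IH]; first by rewrite /eval /= mulg1.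
by rewrite eval_rcons mulgA -IH /run foldl_rcons.
Qed.

Lemma eval_cat u w : eval (u ++ w) = eval u * eval w.
Proof. by rewrite /eval run_cat eval_run. Qed.

Lemma eval_cons l w : eval (l :: w) = lval l * eval w.
Proof. by rewrite -cat1s eval_cat {1}/eval /= mul1g. Qed.

Lemma lval_linv l : lval (linv l) = (lval l)^-1.
Proof. by rewrite /lval odd_linv half_linv; case: (odd l); rewrite ?invgK. Qed.

Lemma eval_winv w : eval (winv w) = (eval w)^-1.
Proof.
have : eval w * eval (winv w) = 1.
  rewrite -eval_run -[X in run _ X]mul1g -eval_run.
  apply: (@run_winv _ (fun=> True)) => // l x _.
  by rewrite lval_linv mulgK.
by move/(congr1 (mulg (eval w)^-1)); rewrite mulKg mulg1.
Qed.
End Evaluation.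

(** The certificates come from the following construction. Let [L] be a subgroup
    containing the central generators and [psi] a homomorphism from [L] to [Z/N].
    Then [G] acts on the set of cosets of [L] decorated by labels in [Z/N]: the
    edge from the coset of [x] to that of [x g] has weight
    [psi (rep x * g * (rep (x g))^-1)]. Only the finitely many cosets reached by
    the words of a prefix-closed list [P] are kept. Each generator is then a
    partial injection of a finite set, which is extended arbitrarily to a
    permutation; this changes nothing for the words in [P]. *)
Section SchreierGraph.
Local Open Scope group_scope.
Variables (G : groupType) (n m : nat) (gen : nat -> G).
Hypothesis gen1 : forall i, n + m <= i -> gen i = 1.
Variable L : set G.
Hypothesis subL : is_subgroup L.
Hypothesis gen_central : forall i x, n <= i -> commute (gen i) x.
Hypothesis gen_L : forall i, n <= i -> L (gen i).
Variables (N : nat) (psi : G -> int).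
Hypothesis psiM : forall x y, L x -> L y ->
  ((psi (x * y) %% N)%Z = ((psi x + psi y)%R %% N)%Z).
Variable P : seq (seq nat).
Hypothesis P0 : [::] \in P.
Hypothesis P_prefix : forall w l, rcons w l \in P -> w \in P.

Let L1 := subgroup1 subL.
Let LV := subgroupV subL.
Let LM := subgroupM subL.

(** A representative of the coset of [x] that depends only on the coset. *)
Definition rep x : G := xget 1 [set y | L (y * x^-1)]%classic.

Lemma repP x : L (rep x * x^-1).
Proof.
rewrite /rep; case: xgetP => // /(_ x) /=.
by rewrite mulgV.
Qed.

Lemma rep_eq x y : L (x * y^-1) -> rep x = rep y.
Proof.
move=> Lxy; rewrite /rep; congr xget; apply/seteqP; split=> z /= Lz.
  by rewrite -(mulgKV x z) -mulgA; apply: LM.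
rewrite -(mulgKV y z) -mulgA; apply: LM => //; exact: (subgroupVM subL).
Qed.

Lemma rep_inj x y : rep x = rep y -> L (x * y^-1).
Proof.
move=> e; rewrite -(mulgKV (rep x) x) -mulgA {2}e; apply: LM (repP y).
by apply: (subgroupVM subL); apply: repP.
Qed.

Lemma rep_rep x : rep (rep x) = rep x.
Proof. exact/rep_eq/repP. Qed.

Lemma rep_mul x y : rep (rep x * y) = rep (x * y).
Proof. by apply: rep_eq; rewrite invMg mulgA mulgK; apply: repP. Qed.

(** The coset of [1] comes first because certificates have base vertex [0]. *)
Definition vertices_tail :=
  [seq x <- undup [seq rep (eval gen w) | w <- P] | x != rep 1].
Definition vertices := rep 1 :: vertices_tail.
Notation d := (size vertices_tail).+1.
Definition vert v := nth 1 vertices v.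
Definition idx x := index (rep x) vertices.
Definition visited x := rep x \in vertices.

Lemma vertices_uniq : uniq vertices.
Proof. by rewrite /= mem_filter eqxx /= filter_uniq ?undup_uniq. Qed.

Lemma visited_eval w : w \in P -> visited (eval gen w).
Proof.
move=> wP; rewrite /visited inE mem_filter mem_undup.
by case: eqP => //= _; apply/mapP; exists w.
Qed.

Lemma vertP v : v < d -> exists2 w, w \in P & vert v = rep (eval gen w).
Proof.
move=> lt_v; have : vert v \in vertices by apply: mem_nth.
rewrite inE mem_filter mem_undup => /orP[/eqP->|/andP[_ /mapP//]].
by exists [::].
Qed.

Lemma rep_vert v : v < d -> rep (vert v) = vert v.
Proof. by move/vertP => [w _ ->]; rewrite rep_rep. Qed.

Lemma idx_vert v : v < d -> idx (vert v) = v.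
Proof. by move=> lt_v; rewrite /idx rep_vert // index_uniq ?vertices_uniq. Qed.

Lemma idx_lt x : visited x -> idx x < d.
Proof. by rewrite /visited -index_mem. Qed.

Lemma vert_idx x : visited x -> vert (idx x) = rep x.
Proof. exact: nth_index. Qed.

Lemma idx_rep x : idx (rep x) = idx x.
Proof. by rewrite /idx rep_rep. Qed.

Lemma visited_rep x : visited (rep x) = visited x.
Proof. by rewrite /visited rep_rep. Qed.

Definition defined i : {set 'I_d} := [set v : 'I_d | visited (vert v * gen i)]%SET.

Lemma defined_inj i :
  {in defined i &, injective (fun v : 'I_d => inord (idx (vert v * gen i)) : 'I_d)}.
Proof.
move=> u v; rewrite !inE => du dv /(congr1 val) /=.
rewrite !inordK ?idx_lt // => /(congr1 vert); rewrite !vert_idx // => /rep_inj.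
rewrite invMg mulgA mulgK => /rep_eq; rewrite !rep_vert // => e.
by apply: val_inj; rewrite /= -[LHS]idx_vert // e idx_vert.
Qed.

Definition sigma i : {perm 'I_d} := sval (cid (extend_perm (@defined_inj i))).

Lemma sigmaE i (v : 'I_d) : v \in defined i -> sigma i v = idx (vert v * gen i) :> nat.
Proof.
rewrite /sigma; case: cid => s /= sE dv; rewrite sE // inordK // idx_lt //.
by move: dv; rewrite inE.
Qed.

(** The edges invented by the extension to permutations get weight [1]: this is
    what detects subgroups of infinite index in [exit_loop]. *)
Definition weight i (v : 'I_d) : int :=
  if v \in defined i then psi (vert v * gen i * (vert (sigma i v))^-1) else 1%R.

Definition edge_fun l (v : 'I_d) : nat * (nat * nat) :=
  if odd l then
    (val ((sigma l./2)^-1 v), zpair (- weight l./2 ((sigma l./2)^-1%g v))%R)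
  else (val (sigma l./2 v), zpair (weight l./2 v)).

Definition schreier_cert : cert :=
  (d, (N, mkseq (fun l => mkseq (fun v => edge_fun l (inord v)) d) (n + m).*2)).

Lemma edge_schreier l (v : 'I_d) : l < (n + m).*2 ->
  edge schreier_cert l v = edge_fun l v.
Proof. by move=> lt_l; rewrite /edge /= nth_mkseq // nth_mkseq // inord_val. Qed.

Lemma central_defined i (v : 'I_d) : n <= i -> v \in defined i.
Proof.
move=> le_i; rewrite inE /visited.
suff -> : rep (vert v * gen i) = vert v by apply: mem_nth.
rewrite -[RHS](rep_vert (ltn_ord v)); apply: rep_eq.
by rewrite -(gen_central _ le_i) mulgK; apply: gen_L.
Qed.

Lemma central_sigma i (v : 'I_d) : n <= i -> sigma i v = v.
Proof.
move=> le_i; apply: val_inj; rewrite /= sigmaE ?central_defined //.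
rewrite -[RHS]idx_vert // /idx; congr index; apply: rep_eq.
by rewrite -(gen_central _ le_i) mulgK; apply: gen_L.
Qed.

Lemma central_weight i (v : 'I_d) : n <= i -> weight i v = psi (gen i).
Proof.
move=> le_i; rewrite /weight central_defined // central_sigma //.
by rewrite -(gen_central _ le_i) mulgK.
Qed.

Lemma schreier_good : good_cert n m schreier_cert.
Proof.
apply/andP; split=> //; apply/allP => l; rewrite mem_iota add0n => lt_l.
apply/allP => v; rewrite mem_iota add0n => lt_v.
rewrite -[v](inordK lt_v); move: (inord v) => {lt_v}v.
have lt_l' : linv l < (n + m).*2 by rewrite linv_ltn.
apply/and4P; split.
- by rewrite edge_schreier // /edge_fun; case: ifP => _; apply: ltn_ord.
- rewrite edge_schreier // /edge_fun; case: ifP => ol /=.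
    rewrite edge_schreier // /edge_fun odd_linv ol half_linv /=.
    by rewrite permKV.
  by rewrite edge_schreier // /edge_fun odd_linv ol half_linv /= permK.
- rewrite edge_schreier // /edge_fun; case: ifP => ol.
    rewrite edge_schreier // /edge_fun odd_linv ol half_linv /=.
    by rewrite zpairN.
  rewrite edge_schreier // /edge_fun odd_linv ol half_linv /= permK.
  by rewrite addnC zpairN [X in _ == X %% _]addnC.
- apply/implyP => le_l; have le_i : n <= l./2 by lia.
  have -> : edge schreier_cert l 0 = edge_fun l ord0 by exact: (edge_schreier ord0).
  rewrite edge_schreier // /edge_fun.
  have sV (u : 'I_d) : (sigma l./2)^-1 u = u.
    by rewrite -{1}(central_sigma u le_i) permK.
  by case: ifP => _; rewrite ?sV ?central_sigma ?central_weight.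
Qed.

Notation crun_schreier := (run (cact n m schreier_cert) (0, 0%R)).
Notation modN := (modc schreier_cert).

Lemma cact_pos i (v : 'I_d) z : i < n + m ->
  cact n m schreier_cert i.*2 (val v, z) = (val (sigma i v), modN (z + weight i v)%R).
Proof.
move=> lt_i; rewrite /cact ltn_double lt_i /= edge_schreier ?ltn_double //.
by rewrite /edge_fun odd_double doubleK /= -addrA zpairK.
Qed.

Lemma cact_neg i (v : 'I_d) z : i < n + m ->
  cact n m schreier_cert i.*2.+1 (val (sigma i v), z)
    = (val v, modN (z - weight i v)%R).
Proof.
move=> lt_i; have lt_l : i.*2.+1 < (n + m).*2 by lia.
rewrite /cact lt_l /= edge_schreier // /edge_fun /= odd_double uphalf_double /= permK.
by rewrite -addrA zpairK.
Qed.

Let psi1 : modN (psi 1) = 0%R.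
Proof.
have := psiM L1 L1; rewrite mulg1 => /eqP; rewrite eqz_mod_dvd.
by rewrite opprD addrA subrr sub0r rpredN => /dvdz_mod0P.
Qed.

Let Lrep x : L (x * (rep x)^-1).
Proof. by apply: (subgroupVM subL); apply: repP. Qed.

(** The weights telescope along a word all of whose prefixes are visited. *)
Lemma crun_schreierE w : w \in P ->
  crun_schreier w = (idx (eval gen w),
    modN (psi (rep 1 * eval gen w * (rep (eval gen w))^-1))).
Proof.
have Lr1 : L (rep 1) by have := repP 1; rewrite invg1 mulg1.
elim/last_ind: w => [_|w l IH wlP].
  rewrite /eval /= mulg1 mulgV psi1; congr (_, _).
  by rewrite /idx /= eqxx.
have wP := P_prefix wlP.
have {IH} := IH wP; have := visited_eval wP; have := visited_eval wlP.
rewrite eval_rcons /run foldl_rcons -/(run _ _ _) => vxl vx ->.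
move: (eval gen w) vx vxl => x vx vxl.
case: (ltnP l (n + m).*2) => [lt_l|le_l]; last first.
  rewrite cact_id // /lval gen1 ?invg1; last by lia.
  by case: ifP; rewrite mulg1.
have [i ii] : exists i, i = l./2 by eexists.
have lt_i : i < n + m by lia.
move: vxl; rewrite /lval -ii; case: ifP => ol vy.
  have -> : l = i.*2.+1 by rewrite ii -{1}[l]odd_double_half ol.
  set y := x * (gen i)^-1 in vy *.
  have yg : y * gen i = x by rewrite mulgKV.
  pose v : 'I_d := Ordinal (idx_lt vy).
  have vv : vert v = rep y by rewrite vert_idx.
  have dv : v \in defined i by rewrite inE vv -visited_rep rep_mul yg visited_rep.
  have sv : sigma i v = idx x :> nat.
    by rewrite sigmaE // vv -idx_rep rep_mul yg idx_rep.
  rewrite -sv cact_neg //; congr (_, _).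
  rewrite /weight dv vv sv vert_idx // modcDl.
  have := @psiM (rep 1 * y * (rep y)^-1) (rep y * gen i * (rep x)^-1).
  have -> : rep 1 * y * (rep y)^-1 * (rep y * gen i * (rep x)^-1)
      = rep 1 * x * (rep x)^-1.
    by rewrite -!mulgA !mulKg.
  rewrite -!/(modN _) => e; rewrite -modcDl e; last 2 first.
  - by rewrite -mulgA; apply: LM.
  - rewrite -[gen i](mulKg y) yg !mulgA -[_ * x * _]mulgA; apply: LM => //.
    exact: repP.
  by rewrite modcDl addrK.
have -> : l = i.*2 by rewrite ii -{1}[l]odd_double_half ol.
set y := x * gen i in vy *.
pose v : 'I_d := Ordinal (idx_lt vx).
have vv : vert v = rep x by rewrite vert_idx.
have dv : v \in defined i by rewrite inE vv -visited_rep rep_mul visited_rep.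
have sv : sigma i v = idx y :> nat by rewrite sigmaE // vv -idx_rep rep_mul idx_rep.
rewrite (cact_pos v _ lt_i) /= sv; congr (_, _).
rewrite /weight dv vv sv vert_idx // modcDl.
rewrite -[RHS]/((psi _ %% N)%Z).
have -> : rep 1 * y * (rep y)^-1
    = (rep 1 * x * (rep x)^-1) * (rep x * gen i * (rep y)^-1).
  by rewrite -!mulgA mulKg !mulgA.
rewrite psiM //.
- by rewrite -mulgA; apply: LM.
- have -> : rep x * gen i * (rep y)^-1 = (rep x * x^-1) * (y * (rep y)^-1).
    by rewrite -!mulgA mulKg.
  by apply: LM => //; apply: repP.
Qed.

Lemma crun_schreier_in w : w \in P -> L (eval gen w) ->
  crun_schreier w = (0, modN (psi (eval gen w))).
Proof.
move=> wP Lw; rewrite crun_schreierE //.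
have Lr1 : L (rep 1) by have := repP 1; rewrite invg1 mulg1.
have -> : rep (eval gen w) = rep 1 by apply: rep_eq; rewrite invg1 mulg1.
have -> : idx (eval gen w) = 0.
  by rewrite /idx (_ : rep _ = rep 1) /= ?eqxx //; apply: rep_eq; rewrite invg1 mulg1.
congr (_, _); rewrite -[LHS]/((psi _ %% N)%Z) psiM; last exact: LV; last exact: LM.
rewrite -[LHS]/(modN _) -modcDl -[modN (psi (_ * _))]/((psi _ %% N)%Z) psiM //.
rewrite -[(_ %% N)%Z]/(modN _) modcDl addrAC -modcDl.
rewrite -[modN (psi (rep 1) + _)]/((_ %% N)%Z) -psiM ?mulgV //; last exact: LV.
by rewrite -[(_ %% N)%Z]/(modN _) psi1 add0r.
Qed.

Lemma crun_schreier_out w : w \in P -> ~ L (eval gen w) ->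
  (crun_schreier w).1 <> 0.
Proof.
move=> wP Lw; rewrite crun_schreierE //= => idx0; apply: Lw.
have := vert_idx (visited_eval wP); rewrite idx0 => /rep_inj.
by rewrite mul1g => /LV; rewrite invgK.
Qed.

(** If no edge leaves the visited cosets, these are all the cosets; inverse
    letters are covered since an injection of a finite set is surjective. *)
Lemma visited_all :
  (forall i, i < n + m -> forall v : 'I_d, v \in defined i) ->
  forall w, visited (eval gen w).
Proof.
move=> def; elim/last_ind => [|w l vx]; first exact: visited_eval.
rewrite eval_rcons; move: (eval gen w) vx => x vx.
pose i := l./2; case: (ltnP i (n + m)) => [lt_i|le_i]; last first.
  by rewrite /lval gen1 // invg1; case: ifP; rewrite mulg1.
pose v : 'I_d := Ordinal (idx_lt vx).
have vv : vert v = rep x by rewrite vert_idx.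
rewrite /lval -/i; case: ifP => _.
  pose v' := (sigma i)^-1 v.
  have := sigmaE (def i lt_i v'); rewrite permKV => /(congr1 vert).
  have := def i lt_i v'; rewrite inE => vis; rewrite vert_idx // vv => e.
  rewrite /visited -rep_mul e rep_mul mulgK rep_vert //.
  exact: mem_nth.
by have := def i lt_i v; rewrite inE vv -visited_rep rep_mul visited_rep.
Qed.

Section ExitLoop.
Hypothesis N0 : N = 0.
Hypothesis psi0 : forall x, psi x = 0%R.

Lemma weight_ge0 i v : (0 <= weight i v)%R.
Proof. by rewrite /weight psi0; case: ifP. Qed.

(** All weights are nonnegative when [psi] vanishes, so going along powers of a
    generator never decreases the label. *)
Lemma crun_loop i t (v : 'I_d) z : i < n + m -> exists2 z' : int,
  run (cact n m schreier_cert) (val v, z) (nseq t i.*2)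
    = (val ((sigma i ^+ t) v), z')
  & (z <= z')%R.
Proof.
move=> lt_i; elim: t v z => [|t IH] v z; first by exists z; rewrite ?perm1.
rewrite [run _ _ _]/= (cact_pos v z lt_i) expgS permM.
have [z' -> le_z'] := IH (sigma i v) (modN (z + weight i v)%R).
exists z' => //; apply: le_trans le_z'.
by rewrite /modc /= N0 modz0 lerDl weight_ge0.
Qed.

(** An edge leaving the visited cosets is replaced in the certificate by an edge
    of weight [1], and the cycle of the permutation through it is a loop of
    positive weight. *)
Lemma exit_loop :
  (exists u y, let c := schreier_cert in
     (crun n m c u).1 = (crun n m c (u ++ y)).1 /\
     (crun n m c u).2.1 + (crun n m c (u ++ y)).2.2 !=
     (crun n m c u).2.2 + (crun n m c (u ++ y)).2.1) \/
  forall w, visited (eval gen w).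
Proof.
have [def|] := pselect (forall i, i < n + m -> forall v : 'I_d, v \in defined i).
  by right; apply: visited_all.
move=> /existsNP[i] /not_implyP[lt_i /existsNP[v /negP ndef]]; left.
have [u uP vu] := vertP (ltn_ord v).
(* The order of the permutation closes the loop through the exit vertex. *)
exists u, (nseq #[sigma i] i.*2) => /=.
have run_u : crun_schreier u = (val v, 0%R).
  by rewrite crun_schreierE // psi0 /modc mod0z -idx_rep -vu idx_vert.
have run_uy : exists2 z : int,
    crun_schreier (u ++ nseq #[sigma i] i.*2) = (val v, z) & (1 <= z)%R.
  rewrite run_cat run_u; have := order_gt0 (sigma i).
  have := expg_order (sigma i); case: #[_] => // t st _.
  rewrite [run _ _ _]/= cact_pos // /weight (negPf ndef) add0r.
  have [z -> le_z] := crun_loop t (sigma i v) (modN 1%R) lt_i.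
  exists z; first by rewrite -permM -expgS st perm1.
  by apply: le_trans le_z; rewrite /modc /= N0 modz0.
have {run_uy} [z] := run_uy; rewrite -sem_crun /sem => -[e1 ez] z1.
move: run_u; rewrite -sem_crun /sem => -[e2 eu]; split; first by rewrite e1 e2.
move: ez eu z1; rewrite /modc /= N0 !modz0; lia.
Qed.
End ExitLoop.
End SchreierGraph.

(** * Subgroups of Z^m *)

Section Lattices.
Local Open Scope ring_scope.
Variables (m : nat) (B : 'rV[int]_m -> Prop).
Hypothesis B0 : B 0.
Hypothesis BB : forall x y, B x -> B y -> B (x - y).

Let BD x y : B x -> B y -> B (x + y).
Proof. by move=> Bx By; rewrite -[y]opprK -[- y]sub0r; apply/BB/BB. Qed.

Let BZ (z : int) x : B x -> B (z *: x).
Proof.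
move=> Bx; have Bn k : B (k%:Z *: x).
  by elim: k => [|k IH]; rewrite ?scale0r // intS scalerDl scale1r; apply: BD.
case: z => k; first exact: Bn.
rewrite NegzE scaleNr -[- _]sub0r; exact: BB.
Qed.

(** Echelon form: the vectors of the lattice whose first [i] coordinates vanish
    are generated by those with one more vanishing coordinate, together with one
    vector whose coordinate [i] is nonzero of least absolute value. *)
Lemma lattice_fg : exists l (M : 'M[int]_(l, m)),
  forall x, B x <-> exists y : 'rV_l, x = y *m M.
Proof.
suff fg k i : (i + k = m)%N -> exists l (M : 'M[int]_(l, m)), forall x,
    (B x /\ forall j : 'I_m, (j < i)%N -> x 0 j = 0) <-> exists y : 'rV_l, x = y *m M.
  have [l [M MP]] := fg m 0%N (add0n m); exists l, M => x.
  by rewrite -MP; split=> [Bx|[]].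
elim: k i => [|k IH] i im.
  exists 0%N, 0 => x; split=> [[_ x0]|[y ->]]; last first.
    by rewrite mulmx0; split=> // j _; rewrite mxE.
  exists 0; rewrite mulmx0; apply/rowP => j; rewrite [RHS]mxE; apply: x0.
  by have := ltn_ord j; lia.
have lt_i : (i < m)%N by lia.
have [l [M MP]] := IH i.+1 ltac:(lia).
pose oi := Ordinal lt_i.
pose Bi x := B x /\ forall j : 'I_m, (j < i)%N -> x 0 j = 0.
have [[x1 [Bx1 nx1]]|none] := pselect (exists x, Bi x /\ x 0 oi != 0); last first.
  exists l, M => x; rewrite -MP.
  split=> [[Bx x0]|[Bx x0]]; split=> // j lt_j; last first.
    by apply: x0; lia.
  case: (ltngtP j i) => [/x0//||ji]; first by lia.
  have -> : j = oi by apply: val_inj.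
  by apply/eqP/negP => /negP nx; apply: none; exists x.
pose Q k := `[< exists x, Bi x /\ x 0 oi != 0 /\ absz (x 0 oi) = k >].
have Qex : exists k, Q k by exists (absz (x1 0 oi)); apply/asboolP; exists x1.
case: (ex_minnP Qex) => g /asboolP[b [[Bb b0] [nb bg]]] g_min.
exists (1 + l)%N, (col_mx b M) => x; split=> [[Bx x0]|[y ->]]; last first.
  rewrite -[y]hsubmxK mul_row_col.
  have [BM M0] : B (rsubmx y *m M) /\
      forall j : 'I_m, (j < i.+1)%N -> (rsubmx y *m M) 0 j = 0.
    by apply/MP; exists (rsubmx y).
  rewrite [lsubmx y]mx11_scalar mul_scalar_mx; split.
    by apply: BD => //; apply: BZ.
  by move=> j lt_j; rewrite mxE mxE b0 // M0 ?mulr0 ?addr0 //; lia.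
pose q := divz (x 0 oi) (b 0 oi).
have Br : B (x - q *: b) by apply/BB => //; apply: BZ.
have r0 (j : 'I_m) : (j < i)%N -> (x - q *: b) 0 j = 0.
  by move=> lt_j; rewrite !mxE x0 // b0 // mulr0 subrr.
have rE : (x - q *: b) 0 oi = modz (x 0 oi) (b 0 oi) by rewrite !mxE /q /modz.
have ri : (x - q *: b) 0 oi = 0.
  apply/eqP/negP => /negP nr.
  pose r := x - q *: b.
  have : (g <= absz (r 0%R oi))%N by apply: g_min; apply/asboolP; exists r.
  rewrite -bg /r rE leqNgt => /negP; apply; rewrite -ltz_nat !abszE.
  by rewrite [X in X < _]ger0_norm ?modz_ge0 // ltz_mod.
have [y yE] : exists y : 'rV_l, x - q *: b = y *m M.
  apply/MP; split=> // j; rewrite ltnS leq_eqVlt => /orP[/eqP ji|]; last exact: r0.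
  by have -> : j = oi by apply: val_inj.
(* Coordinates: the quotient [q] on [b], then those of the remainder. *)
exists (row_mx q%:M y); rewrite mul_row_col mul_scalar_mx -yE.
by rewrite addrC subrK.
Qed.

(** Smith normal form: after a unimodular change of coordinates the lattice is a
    product of subgroups [N_j Z]. Each coordinate is then a homomorphism to
    [Z/N_j] killing the lattice, together they separate the points outside it,
    and the lattice has infinite index exactly when some [N_j] is [0]. *)
Lemma lattice_coordinates : exists (Q : 'M[int]_m) (N : 'I_m -> nat),
  Q \in unitmx /\ forall x, B x <-> forall j, ((N j)%:Z %| (x *m Q) 0%R j)%Z.
Proof.
have [l [M MP]] := lattice_fg.
have [L Lu [R Ru [d _ ME]]] := int_Smith_normal_form M.
exists (invmx R), (fun j => if (j < l)%N then absz (nth 0%R d j) else 0%N).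
split; first by rewrite unitmx_inv.
move=> x; rewrite MP ME.
set D := \matrix_(i, j) _.
have DE (y : 'rV_l) (j : 'I_m) :
    (y *m D) 0 j = if insub (val j) is Some i then y 0 i * d`_j else 0.
  rewrite mxE; case: insubP => [i _ ij|].
    rewrite (bigD1 i) //= big1 ?addr0 => [|i' ne]; rewrite mxE ?ij ?eqxx ?mulr1n //.
    by rewrite -ij (inj_eq val_inj) (negPf ne) mulr0.
  rewrite -leqNgt => le_l; apply: big1 => i _; rewrite mxE.
  by case: eqP => [e|]; rewrite ?mulr0 //; move: (ltn_ord i); rewrite e ltnNge le_l.
split=> [[y ->] j|dvd].
  rewrite !mulmxA mulmxK // DE; case: insubP => [i lt_j _|/negPf->]; last exact: dvdz0.
  by rewrite lt_j dvdzE abszM absz_nat dvdn_mull.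
pose y : 'rV_l := \row_i
  (if insub (val i) is Some j then divz ((x *m invmx R) 0 j) d`_i else 0).
exists (y *m invmx L); rewrite !mulmxA mulmxKV //.
apply: (can_inj (mulmxK Ru)) => /=; rewrite ?mulmxK //.
suff -> : y *m D = x *m invmx R by rewrite mulmxKV.
apply/rowP => j; rewrite DE; have := dvd j.
case: insubP => [i lt_j ij|/negPf->]; last by rewrite dvd0z => /eqP->.
have ij' : nat_of_ord i = j by exact: ij.
rewrite lt_j /y [in X in _ -> X]mxE ij'.
case: insubP => [j' _ j'E dv|/negP[]]; last by rewrite ij; exact: ltn_ord.
have -> : j' = j by apply: val_inj; rewrite j'E.
by rewrite divzK.
Qed.
End Lattices.

(** * Groups with central generators and a free complement *)

Section CentralExtension.
Variables (n m : nat).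

(** The exponents of the central generators. *)
Definition expo (w : seq nat) : 'rV[int]_m :=
  (\row_j ((count_mem (n + j).*2 w)%:Z - (count_mem (n + j).*2.+1 w)%:Z))%R.

Lemma expo_cat u w : expo (u ++ w) = (expo u + expo w)%R.
Proof. by apply/rowP => j; rewrite !mxE !count_cat !PoszD; ring. Qed.

Lemma expo_winv w : expo (winv w) = (- expo w)%R.
Proof.
apply/rowP => j; rewrite !mxE !count_winv /linv /= odd_double /=.
by ring.
Qed.

Lemma fpart_cat u w : fpart n (u ++ w) = fpart n u ++ fpart n w.
Proof. exact: filter_cat. Qed.

Lemma fpart_winv w : fpart n (winv w) = winv (fpart n w).
Proof.
rewrite /fpart /winv filter_rev filter_map; congr (rev (map _ _)).
by apply: eq_filter => l /=; rewrite linv_ltn.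
Qed.

Lemma trivial_wordP w :
  reflect (freduce (fpart n w) = [::] /\ expo w = 0%R) (trivial_word n m w).
Proof.
apply: (iffP andP) => [[/eqP f0 /allP bal]|[-> e0]]; split=> //.
  apply/rowP => j; rewrite !mxE; apply/eqP; rewrite subr_eq0 eqz_nat.
  have := bal (n + j).*2; rewrite /linv odd_double; apply.
  by rewrite mem_iota; have := ltn_ord j; lia.
apply/allP => l; rewrite mem_iota => l_c.
have [i Ei] : exists i, i = l./2 by exists l./2.
have lt_j : i - n < m by lia.
move/rowP/(_ (Ordinal lt_j)): e0; rewrite !mxE /= subnKC; last by lia.
move/eqP; rewrite subr_eq0 eqz_nat /linv => bal.
have : l = odd l + i.*2 by rewrite Ei odd_double_half.
by case: (odd l) => -> //; rewrite add1n /= eq_sym.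
Qed.

Lemma expo_gen (j : 'I_m) : expo [:: (n + j).*2] = delta_mx 0%R j.
Proof.
apply/rowP => j'; rewrite !mxE /= !addn0.
have -> : ((n + j).*2 == (n + j').*2.+1) = false by lia.
have -> : ((n + j).*2 == (n + j').*2) = (j' == j).
  by apply/eqP/eqP => [e|->//]; apply: val_inj => /=; lia.
by rewrite subr0; case: eqP.
Qed.

Lemma central_word_ex (e : 'rV[int]_m) : exists w, fpart n w = [::] /\ expo w = e.
Proof.
pose K e := exists w, fpart n w = [::] /\ expo w = e.
have K0 : K 0%R by exists [::]; split=> //; apply/rowP => j; rewrite !mxE.
have KD x y : K x -> K y -> K (x + y)%R.
  by move=> [u [fu <-]] [w [fw <-]]; exists (u ++ w); rewrite fpart_cat fu fw expo_cat.
have KN x : K x -> K (- x)%R.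
  by move=> [u [fu <-]]; exists (winv u); rewrite fpart_winv fu expo_winv.
have Kj (z : int) j : K (z *: delta_mx 0 j)%R.
  have Kn (k : nat) : K (k%:Z *: delta_mx 0 j)%R.
    elim: k => [|k IH]; first by rewrite scale0r.
    rewrite intS scalerDl scale1r; apply: KD IH.
    exists [:: (n + j).*2]; split.
      by rewrite /fpart /= ltn_double ltnNge leq_addr.
    exact: expo_gen.
  case: z => k //; rewrite NegzE scaleNr; exact: KN.
suff : K e by []; rewrite [e]row_sum_delta.
by apply: (big_ind K K0 KD) => j _; apply: Kj.
Qed.

Definition central_word e : seq nat := sval (cid (central_word_ex e)).

Lemma fpart_central_word e : fpart n (central_word e) = [::].
Proof. by rewrite /central_word; case: cid => w []. Qed.

Lemma expo_central_word e : expo (central_word e) = e.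
Proof. by rewrite /central_word; case: cid => w []. Qed.

Local Open Scope group_scope.
Variables (G : groupType) (gen : nat -> G).
Hypothesis gen1 : forall i, n + m <= i -> gen i = 1.
Hypothesis gen_central : forall i x, n <= i -> commute (gen i) x.
(** The first [n] generators freely generate the quotient by the central ones. *)
Hypothesis free_part : forall w, eval gen w = 1 -> freduce (fpart n w) = [::].
Hypothesis gen_surj : forall x, exists w, x = eval gen w.

Lemma lval_central l x : n.*2 <= l -> commute (lval gen l) x.
Proof.
move=> le_l; have c : commute (gen l./2) x by apply: gen_central; lia.
by rewrite /lval; case: ifP => // _; apply/commute_sym/commuteV/commute_sym.
Qed.

Lemma eval_trivial w : trivial_word n m w -> eval gen w = 1.
Proof.
move=> tw; apply: (@run_trivial n m G (fun=> True)) tw I => //.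
- by move=> l x _; rewrite lval_linv mulgK.
- by move=> l l' x le_l _; rewrite -!mulgA (lval_central _ le_l).
- move=> l x le_l; rewrite /lval gen1; last by lia.
  by rewrite invg1; case: ifP; rewrite mulg1.
Qed.

Definition aexp e := eval gen (central_word e).

Lemma eval_expo w : fpart n w = [::] -> eval gen w = aexp (expo w).
Proof.
move=> fw; apply: (mulIg (eval gen (winv (central_word (expo w))))).
rewrite [RHS](_ : _ = 1); last by rewrite eval_winv mulgV.
rewrite -eval_cat eval_trivial //; apply/trivial_wordP.
rewrite fpart_cat fpart_winv fw fpart_central_word; split=> //.
by rewrite expo_cat expo_winv expo_central_word subrr.
Qed.

Lemma aexpD e f : aexp (e + f)%R = aexp e * aexp f.
Proof.
rewrite /aexp -eval_cat [RHS]eval_expo ?expo_cat ?expo_central_word //.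
by rewrite fpart_cat !fpart_central_word.
Qed.

Lemma aexpN e : aexp (- e)%R = (aexp e)^-1.
Proof.
rewrite /aexp -eval_winv [RHS]eval_expo ?expo_winv ?expo_central_word //.
by rewrite fpart_winv fpart_central_word.
Qed.

Lemma aexp0 : aexp 0%R = 1.
Proof. by rewrite -(subrr 0%R) aexpD aexpN mulgV. Qed.

Lemma aexp_gen (j : 'I_m) : aexp (delta_mx 0%R j)%R = gen (n + j).
Proof.
rewrite -expo_gen -eval_expo ?/eval /= ?mul1g ?/lval ?odd_double ?doubleK //.
by rewrite /fpart /= ltn_double ltnNge leq_addr.
Qed.

Lemma aexp_central e x : commute (aexp e) x.
Proof.
rewrite /aexp; have : all (leq n.*2) (central_word e).
  apply/allP => l l_e; rewrite leqNgt; apply/negP => lt_l.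
  have : l \in fpart n (central_word e) by rewrite mem_filter lt_l.
  by rewrite fpart_central_word.
elim/last_ind: (central_word e) => [|w l IH].
  by rewrite /eval /= => _; apply/commute_sym/commute1.
rewrite all_rcons eval_rcons => /andP[le_l /IH {}IH].
apply/commute_sym/commuteM; apply/commute_sym => //.
exact: lval_central.
Qed.

(** The relations between the central generators form a subgroup of [Z^m], hence
    follow from finitely many. Adding such words to the generators of a subgroup
    reduces its membership problem to one in [F_n * Z^m]. *)
Lemma relators_ex : exists R0 : seq (seq nat),
  (forall r, r \in R0 -> eval gen r = 1) /\
  (forall e, aexp e = 1 -> exists us, [/\
     all (fun u => (u \in R0) || (winv u \in R0)) us,
     fpart n (flatten us) = [::] & expo (flatten us) = e]).
Proof.
have [||l [M MP]] := @lattice_fg m (fun e => aexp e = 1).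
- exact: aexp0.
- by move=> x y; rewrite aexpD aexpN => -> ->; rewrite mul1g invg1.
exists [seq central_word (row i M) | i <- enum 'I_l]; split.
  move=> r /mapP[i _ ->]; rewrite -/(aexp _); apply/MP.
  by exists (delta_mx 0%R i); rewrite rowE.
set R0 := map _ _.
pose K e := exists us, [/\
     all (fun u => (u \in R0) || (winv u \in R0)) us,
     fpart n (flatten us) = [::] & expo (flatten us) = e].
have K0 : K 0%R by exists [::]; split=> //; apply/rowP => j; rewrite !mxE.
have KD x y : K x -> K y -> K (x + y)%R.
  move=> [us [Rus fus <-]] [vs [Rvs fvs <-]]; exists (us ++ vs).
  by rewrite all_cat Rus Rvs flatten_cat fpart_cat fus fvs expo_cat.
have KN x : K x -> K (- x)%R.
  move=> [us [Rus fus <-]]; exists (rev (map winv us)).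
  have -> : flatten (rev (map winv us)) = winv (flatten us).
    elim: (us) => //= u us' IH.
    by rewrite winv_cat rev_cons -cats1 flatten_cat IH /= cats0.
  rewrite fpart_winv fus expo_winv; split=> //.
  rewrite all_rev all_map; apply: sub_all Rus => u /=.
  by rewrite winvK orbC.
have Kj (z : int) i : K (z *: row i M)%R.
  have Kn (k : nat) : K (k%:Z *: row i M)%R.
    elim: k => [|k IH]; first by rewrite scale0r.
    rewrite intS scalerDl scale1r; apply: KD IH.
    exists [:: central_word (row i M)].
    rewrite /= cats0 expo_central_word fpart_central_word; split=> //.
    have -> // : central_word (row i M) \in R0.
    by apply/mapP; exists i; rewrite ?mem_enum.
  case: z => k //; rewrite NegzE scaleNr; exact: KN.
move=> e /MP[y ->]; suff : K (y *m M)%R by [].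
by rewrite mulmx_sum_row; apply: (big_ind K K0 KD) => i _; apply: Kj.
Qed.

Section Subgroup.
Variable R0 : seq (seq nat).
Hypothesis R0_eval : forall r, r \in R0 -> eval gen r = 1.
Hypothesis R0_span : forall e, aexp e = 1 -> exists us, [/\
     all (fun u => (u \in R0) || (winv u \in R0)) us,
     fpart n (flatten us) = [::] & expo (flatten us) = e].
Variable s : seq (seq nat).

Definition words_set : set G := [set x | exists2 w, w \in s & x = eval gen w]%classic.
Let H := Defs.generated words_set.

Lemma gen_subgroup : is_subgroup H.
Proof.
split=> [K [[]]//|x y Hx Hy K KS]; have [[_ KB] _] := KS.
exact: KB (Hx K KS) (Hy K KS).
Qed.

Let H1 := subgroup1 gen_subgroup.
Let HV := subgroupV gen_subgroup.
Let HM := subgroupM gen_subgroup.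

Lemma H_word w : w \in s -> H (eval gen w).
Proof. by move=> ws K [_]; apply; exists w. Qed.

Lemma H_words x : H x -> exists us,
  all (fun u => (u \in s) || (winv u \in s)) us /\ x = eval gen (flatten us).
Proof.
pose K : set G := [set x | exists us,
  all (fun u => (u \in s) || (winv u \in s)) us /\ x = eval gen (flatten us)]%classic.
move=> /(_ K); apply; split; last first.
  by move=> _ [w ws ->]; exists [:: w]; rewrite /= ws cats0.
split=> [|_ _ [us [us_s ->]] [vs [vs_s ->]]]; first by exists [::].
exists (us ++ rev (map winv vs)); split.
  rewrite all_cat us_s all_rev all_map; apply: sub_all vs_s => u /=.
  by rewrite winvK orbC.
rewrite flatten_cat eval_cat; congr (_ * _).
rewrite -eval_winv; congr eval; elim: (vs) => //= u vs' IH.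
by rewrite winv_cat rev_cons -cats1 flatten_cat IH /= cats0.
Qed.

Lemma pos_cert_sound w us : pos_cert n m (s ++ R0) w us -> H (eval gen w).
Proof.
case/andP=> us_S /eval_trivial; rewrite eval_cat => e.
suff Hus : H (eval gen (flatten us)).
  by rewrite -[eval gen w](mulgK (eval gen (flatten us))) e mul1g; apply: HV.
elim: us us_S {e} => [|u us IH] /=; first by move=> _; apply: H1.
rewrite eval_cat => /andP[u_S /IH]; apply: HM.
have HS v : v \in s ++ R0 -> H (eval gen v).
  by rewrite mem_cat => /orP[/H_word//|/R0_eval->]; apply: H1.
by case/orP: u_S => /HS //; rewrite eval_winv => /HV; rewrite invgK.
Qed.

(** A product of generators representing the inverse of [w] differs from it, in
    [F_n * Z^m], by a relation between central generators. *)
Lemma pos_cert_ex w : H (eval gen w) -> exists us, pos_cert n m (s ++ R0) w us.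
Proof.
move=> /HV/H_words[us [us_s e]].
have e1 : eval gen (w ++ flatten us) = 1 by rewrite eval_cat -e mulgV.
have f1 := free_part e1.
have tv : trivial_word n m
    ((w ++ flatten us) ++ winv (central_word (expo (w ++ flatten us)))).
  apply/trivial_wordP; rewrite fpart_cat fpart_winv fpart_central_word cats0.
  by rewrite f1 expo_cat expo_winv expo_central_word subrr.
have := eval_trivial tv; rewrite eval_cat e1 mul1g eval_winv -/(aexp _) -aexpN.
move=> /R0_span[rs [rs_R frs ers]]; exists (us ++ rs).
apply/andP; split.
  rewrite all_cat; apply/andP; split.
    by apply: sub_all us_s => u; rewrite !mem_cat => /orP[->|->]; rewrite ?orbT.
  by apply: sub_all rs_R => u; rewrite !mem_cat => /orP[->|->]; rewrite ?orbT.
apply/trivial_wordP; rewrite flatten_cat catA fpart_cat frs cats0 f1.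
by rewrite expo_cat ers subrr.
Qed.

(** The product of [H] and of the subgroup of the central generators. *)
Definition saturation : set G := [set x | exists e, H (x * (aexp e)^-1)]%classic.

Lemma saturation_subgroup : is_subgroup saturation.
Proof.
split=> [|x y [e He] [f Hf]].
  by exists 0%R; rewrite aexp0 mulgV; apply: H1.
exists (e - f)%R; rewrite aexpD aexpN.
have -> : x * y^-1 * (aexp e * (aexp f)^-1)^-1 = x * (aexp e)^-1 * (y * (aexp f)^-1)^-1.
  rewrite !invMg !invgK -!mulgA -!aexpN; congr (x * _).
  by rewrite [RHS]mulgA -!aexpD [in RHS]addrC aexp_central.
by apply: HM => //; apply: HV.
Qed.

Lemma saturation_central i : n <= i -> saturation (gen i).
Proof.
move=> le_i; case: (ltnP i (n + m)) => [lt_i|/gen1->]; last first.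
  by exists 0%R; rewrite aexp0 mulgV; apply: H1.
have lt_j : i - n < m by lia.
exists (delta_mx 0%R (Ordinal lt_j))%R; rewrite aexp_gen /= subnKC // mulgV.
exact: H1.
Qed.

Lemma saturation_H x : H x -> saturation x.
Proof. by move=> Hx; exists 0%R; rewrite aexp0 invg1 mulg1. Qed.

(** Some exponent of the central part of an element of the saturation; it is
    unique modulo the exponents of the central elements of [H]. *)
Definition exponent x : 'rV[int]_m := xget 0%R [set e | H (x * (aexp e)^-1)]%classic.

Lemma exponentP x : saturation x -> H (x * (aexp (exponent x))^-1).
Proof. by rewrite /exponent => -[e He]; case: xgetP => // /(_ e). Qed.

Lemma exponent_uniq x e f : H (x * (aexp e)^-1) -> H (x * (aexp f)^-1) ->
  H (aexp (e - f)).
Proof.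
move=> He Hf; rewrite aexpD aexpN.
have -> : aexp e * (aexp f)^-1 = (x * (aexp e)^-1)^-1 * (x * (aexp f)^-1).
  by rewrite invMg invgK -!mulgA mulKg.
by apply: HM => //; apply: HV.
Qed.

Variables (Q : 'M[int]_m) (N : 'I_m -> nat).
Hypothesis QN : forall e, H (aexp e) <-> forall j, ((N j)%:Z %| (e *m Q)%R 0%R j)%Z.

(** The homomorphism from the saturation to [Z/N_j] that kills [H]. *)
Definition coordinate j x : int := (exponent x *m Q)%R 0%R j.

Lemma coordinateE j x e : H (x * (aexp e)^-1) ->
  ((coordinate j x %% N j)%Z = ((e *m Q)%R 0%R j %% N j)%Z).
Proof.
move=> He; have Hx := exponentP (ex_intro _ e He).
apply/eqP; rewrite eqz_mod_dvd; have /QN/(_ j) := exponent_uniq Hx He.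
by rewrite mulmxBl [X in (_ %| X)%Z]mxE [X in (_ + X)%R]mxE.
Qed.

Lemma coordinateM j x y : saturation x -> saturation y ->
  ((coordinate j (x * y) %% N j)%Z
    = ((coordinate j x + coordinate j y)%R %% N j)%Z).
Proof.
move=> /exponentP Hx /exponentP Hy.
rewrite (@coordinateE j _ (exponent x + exponent y)%R).
  by rewrite mulmxDl [X in (X %% _)%Z]mxE.
rewrite aexpD.
have -> : x * y * (aexp (exponent x) * aexp (exponent y))^-1
  = x * (aexp (exponent x))^-1 * (y * (aexp (exponent y))^-1).
  rewrite invMg -!aexpN -!mulgA; congr (x * _).
  by rewrite [RHS]aexp_central mulgA.
exact: HM.
Qed.

Definition prefixes (us : seq (seq nat)) :=
  [::] :: flatten [seq [seq take i u | i <- iota 0 (size u).+1] | u <- us].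

Lemma prefixes_nil us : [::] \in prefixes us.
Proof. exact: mem_head. Qed.

Lemma mem_prefixes us u : u \in us -> u \in prefixes us.
Proof.
move=> u_us; rewrite inE; apply/orP; right; apply/flatten_mapP; exists u => //.
by apply/mapP; exists (size u); rewrite ?take_size // mem_iota ltnSn.
Qed.

Lemma prefixes_rcons us w l : rcons w l \in prefixes us -> w \in prefixes us.
Proof.
rewrite !inE => /orP[/eqP|/flatten_mapP[u u_us /mapP[i i_lt e]]].
  by case: w.
apply/orP; right; apply/flatten_mapP; exists u => //; apply/mapP.
have le_i : size w <= i.
  have := congr1 size e; rewrite size_rcons size_take_min => eS.
  by apply: leq_trans (geq_minl i (size u)); rewrite -eS.
exists (size w); last by rewrite -(take_takel _ le_i) -e -cats1 take_size_cat.
rewrite mem_iota /= add0n; apply: leq_ltn_trans le_i _.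
by move: i_lt; rewrite mem_iota.
Qed.

Lemma relators_in_span w : w \in s ++ R0 -> H (eval gen w).
Proof. by rewrite mem_cat => /orP[/H_word//|/R0_eval->]; apply: H1. Qed.

Lemma coordinate_cert j (P : seq (seq nat)) :
  {subset s ++ R0 <= P} -> exists c, [/\
   c.2.1 = N j, good_cert n m c, all (cfix n m c) (s ++ R0) &
   forall w e, w \in prefixes P -> H (eval gen w * (aexp e)^-1) ->
     run (cact n m c) (0, 0%R) w = (0, modc c ((e *m Q)%R 0%R j))].
Proof.
move=> sP.
pose c := schreier_cert n m gen saturation_subgroup (N j) (coordinate j)
  (prefixes_nil P).
have runE w e : w \in prefixes P -> H (eval gen w * (aexp e)^-1) ->
     run (cact n m c) (0, 0%R) w = (0, modc c ((e *m Q)%R 0%R j)).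
  move=> wP He.
  rewrite (crun_schreier_in gen1 _ (@coordinateM j) _ (@prefixes_rcons P)) //.
    by congr (_, _); apply: coordinateE.
  by exists e.
exists c; split=> //.
  by apply: schreier_good => //; apply: saturation_central.
apply/allP => w wS; apply/cfixP; rewrite (runE w 0%R).
- by rewrite mul0mx mxE /modc mod0z.
- exact/mem_prefixes/sP.
- by rewrite aexp0 invg1 mulg1; apply: relators_in_span.
Qed.

Lemma plain_cert (P : seq (seq nat)) (P0 := prefixes_nil P)
    (c := schreier_cert n m gen saturation_subgroup 0 (fun=> 0%R) P0) :
  {subset s ++ R0 <= P} -> good_cert n m c /\ all (cfix n m c) (s ++ R0).
Proof.
move=> sP; split; first by apply: schreier_good => //; apply: saturation_central.
apply/allP => w wS; apply/cfixP.
rewrite (crun_schreier_in gen1 _ _ _ (@prefixes_rcons P)).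
- by rewrite /modc mod0z.
- by move=> *; rewrite addr0.
- exact/mem_prefixes/sP.
- exact: saturation_H (relators_in_span wS).
Qed.

(** Outside the saturation of [H] the cosets alone separate [w] from [H]; inside
    it, one of the coordinates does. *)
Lemma neg_cert_ex w : ~ H (eval gen w) -> exists c, neg_cert n m (s ++ R0) w c.
Proof.
move=> nHw; pose P := w :: s ++ R0.
have sP : {subset s ++ R0 <= P} by move=> u uS; rewrite inE uS orbT.
have wP : w \in prefixes P by apply: mem_prefixes; apply: mem_head.
have [[e He]|nLw] := pselect (saturation (eval gen w)).
  have [j nj] : exists j, ~~ ((N j)%:Z %| (e *m Q)%R 0%R j)%Z.
    apply/existsP; rewrite -negb_forall; apply/negP => /forallP /QN He'.
    by apply: nHw; rewrite -[eval gen w](mulgKV (aexp e)); apply: HM.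
  have [c [cN gc fixS runE]] := coordinate_cert j sP.
  exists c; apply/and3P; split=> //; apply/cfixP; rewrite (runE w e) // => -[].
  by rewrite /modc cN => /dvdz_mod0P; apply/negP.
have [gc fixS] := plain_cert sP.
exists (schreier_cert n m gen saturation_subgroup 0 (fun=> 0%R) (prefixes_nil P)).
apply/and3P; split=> //; apply/cfixP => e.
have := crun_schreier_out (N := 0) (psi := fun=> 0%R) gen1
  (subL := saturation_subgroup) (fun _ _ _ _ => erefl) (P0 := prefixes_nil P)
  (@prefixes_rcons P) wP nLw.
by rewrite e.
Qed.

Definition finite_index (K : set G) :=
  exists ys : seq G, forall x, exists2 y, y \in ys & K (x * y^-1).

(** The exponents can be reduced to the finite box of the remainders modulo the
    [N_j]. *)
Lemma saturation_finite_index : (forall j, 0 < N j) -> Q \in unitmx ->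
  finite_index saturation -> finite_index H.
Proof.
move=> N_gt0 Qu [ys ysP].
pose box (g : {ffun 'I_m -> 'I_(\max_j N j)}) : 'rV[int]_m :=
  (\row_j (g j)%:Z *m invmx Q)%R.
exists [seq aexp (box g) * y | g <- enum {ffun 'I_m -> 'I_(\max_j N j)}, y <- ys] => x.
have Nj0 j : (N j)%:Z%R != 0%R by rewrite eqz_nat -lt0n.
have [y y_ys [e He]] := ysP x.
have r_lt j : `|(e *m Q)%R 0%R j %% N j|%Z < \max_j N j.
  apply: leq_trans (leq_bigmax j); rewrite -ltz_nat abszE ger0_norm.
    by rewrite ltz_pmod // ltz_nat.
  by rewrite modz_ge0.
pose g := [ffun j => Ordinal (r_lt j)].
exists (aexp (box g) * y); first by apply/allpairsP; exists (g, y); rewrite mem_enum.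
have Heg : H (aexp (e - box g)).
  apply/QN => j; rewrite mulmxBl mulmxKV // mxE [X in (_ + X)%R]mxE.
  rewrite -eqz_mod_dvd.
  have -> : (\row_j (g j)%:Z)%R 0%R j = modz ((e *m Q)%R 0%R j) (N j).
    by rewrite mxE ffunE /= abszE ger0_norm // modz_ge0.
  by rewrite modz_mod.
have -> : x * (aexp (box g) * y)^-1 = x * y^-1 * (aexp e)^-1 * aexp (e - box g).
  by rewrite aexpD aexpN invMg !mulgA mulgKV.
exact: HM.
Qed.

(** Either some [N_j] is [0], and the corresponding coordinate is an integral
    weight on the central generators; or the saturation of [H] itself has
    infinite index, and an edge leaves the cosets visited by the generators. *)
Lemma inf_cert_ex : Q \in unitmx -> ~ finite_index H ->
  exists x, inf_cert n m (s ++ R0) x.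
Proof.
move=> Qu ninf.
have [N_gt0|[j Nj]] : (forall j, 0 < N j) \/ exists j, N j = 0.
  have [/forallP|] := boolP [forall j, 0 < N j]; first by left.
  by rewrite negb_forall => /existsP[j]; rewrite lt0n negbK => /eqP; right; exists j.
- pose P := s ++ R0.
  have [gc fixS] : _ /\ _ := @plain_cert P (fun _ => id).
  have [[u [y [e ne]]]|vis] := exit_loop gen1 saturation_subgroup
     (N := 0) (psi := fun=> 0%R) (fun _ _ _ _ => erefl) (prefixes_nil P)
     (@prefixes_rcons P) erefl (fun=> erefl).
    eexists (_, (u, y)); apply/and5P.
    by split; [exact: gc|..|exact: ne] => //; apply/eqP.
  case: ninf; apply: saturation_finite_index => //.
  exists (vertices gen saturation (prefixes P)) => x.
  have [w ->] := gen_surj x; exists (rep saturation (eval gen w)); first exact: vis.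
  have := repP saturation_subgroup (eval gen w).
  case: saturation_subgroup => S1 SB /(SB _ _ S1).
  by rewrite mul1g invMg invgK.
have [i nz] : exists i, Q i j != 0%R.
  apply/existsP; rewrite -negb_forall; apply/negP => /forallP Q0.
  have := congr1 (fun M : 'M[int]_m => M j j) (mulVmx Qu).
  rewrite !mxE eqxx big1 // => i _.
  by rewrite (eqP (Q0 i)) mulr0.
pose l := (n + i).*2.
pose P := [:: l] :: s ++ R0.
have sP : {subset s ++ R0 <= P} by move=> u uS; rewrite inE uS orbT.
have lP : [:: l] \in prefixes P by apply: mem_prefixes; apply: mem_head.
have [c [cN gc fixS runE]] := coordinate_cert j sP.
have runl : run (cact n m c) (0, 0%R) [:: l] = (0, Q i j).
  rewrite (runE _ (delta_mx 0%R i)%R) //.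
    by rewrite /modc cN Nj modz0 -rowE mxE.
  rewrite aexp_gen /l /eval /= mul1g /lval odd_double doubleK mulgV.
  exact: H1.
move: runl; rewrite -sem_crun /sem /modc cN Nj modz0 => -[e1 e2].
exists (c, ([::], [:: l])); apply/and5P; split=> //.
- by rewrite cN Nj.
- by rewrite [(crun _ _ _ (_ ++ _)).1]e1.
- rewrite -[X in X + _ != _]/0 -[X in _ != X + _]/0 !add0n.
  by apply: contraNneq nz => e; rewrite -e2 e subrr.
Qed.

(** Pigeonhole principle applied to the words [u y^i]. *)
Lemma inf_cert_sound x : inf_cert n m (s ++ R0) x -> ~ finite_index H.
Proof.
case: x => c [u y] /inf_certP sep [ys ysP].
pose U i := u ++ flatten (nseq i y).
have [f fP] : {f : nat -> G & forall i,
    f i \in ys /\ H (eval gen (U i) * (f i)^-1)}.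
  apply: (@choice _ _ (fun i z => z \in ys /\ H (eval gen (U i) * z^-1))) => i.
  by have [z zys Hz] := ysP (eval gen (U i)); exists z.
have f_inj : injective f.
  move=> i j fij; have [_ Hi] := fP i; have [_ Hj] := fP j.
  have : H (eval gen (U i ++ winv (U j))).
    rewrite eval_cat eval_winv -(mulgKV (f i) (eval gen (U i))) -mulgA.
    by apply: HM => //; rewrite fij -[_ * _]invgK invMg invgK; apply: HV.
  by move=> /pos_cert_ex[us]; apply: sep.
have : size (map f (iota 0 (size ys).+1)) <= size ys.
  apply: uniq_leq_size; first by rewrite map_inj_uniq ?iota_uniq.
  by move=> z /mapP[i _ ->]; have [] := fP i.
by rewrite size_map size_iota ltnn.
Qed.
End Subgroup.

Theorem certificates : exists R0 : seq (seq nat), forall s : seq (seq nat),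
  let H := Defs.generated (words_set s) in
  [/\ forall w, H (eval gen w) <-> exists us, pos_cert n m (s ++ R0) w us,
      forall w, ~ H (eval gen w) <-> exists c, neg_cert n m (s ++ R0) w c &
      ~ finite_index H <-> exists x, inf_cert n m (s ++ R0) x].
Proof.
have [R0 [R0_eval R0_span]] := relators_ex.
exists R0 => s H.
have [||Q [N [Qu QN]]] := @lattice_coordinates m (fun e => H (aexp e)).
- by rewrite aexp0; apply: (subgroup1 (gen_subgroup s)).
- move=> e f He Hf; rewrite aexpD aexpN.
  by case: (gen_subgroup s) => _; apply.
have pos w : H (eval gen w) <-> exists us, pos_cert n m (s ++ R0) w us.
  split; first exact: pos_cert_ex.
  by move=> [us]; apply: pos_cert_sound.
split=> // [w|].
  split; first exact: (neg_cert_ex R0_eval QN).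
  move=> [c neg] /pos[us /neg_certP nneg].
  by have := nneg c; rewrite neg.
split; first exact: (inf_cert_ex R0_eval QN Qu).
by move=> [x]; apply: inf_cert_sound.
Qed.
End CentralExtension.

(** * Algorithms from certificates *)

(** Both membership and non-membership are certified, so a search for either
    kind of certificate halts. *)
Lemma computable_membership n m (G : groupType) (gen : nat -> G) R0 :
  (forall s w, Defs.generated (words_set gen s) (eval gen w) <->
     exists us, pos_cert n m (s ++ R0) w us) ->
  (forall s w, ~ Defs.generated (words_set gen s) (eval gen w) <->
     exists c, neg_cert n m (s ++ R0) w c) ->
  exists member : seq (seq nat) -> seq nat -> bool,
    computableb (fun c => member c.1 c.2) /\
    forall s w, member s w <-> Defs.generated (words_set gen s) (eval gen w).
Proof.
move=> posE negE.
pose P (z : seq (seq nat) * seq nat) (x : seq (seq nat) * cert) :=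
  pos_cert n m (z.1 ++ R0) z.2 x.1 || neg_cert n m (z.1 ++ R0) z.2 x.2.
have [f [cf fP _]] : exists f, [/\ computable f, forall z, P z (f z) &
    forall z x, P z x -> enc (f z) <= enc x].
  apply: computable_search => [[s w]|].
    have [/posE[us us_w]|/negE[c c_w]] :=
      pselect (Defs.generated (words_set gen s) (eval gen w)).
      by exists (us, (0, (0, [::]))); rewrite /P us_w.
    by exists ([::], c); rewrite /P c_w orbT.
  rewrite /P; comp; first by apply: computableb_pos_cert; comp.
  by apply: computableb_neg_cert; comp.
exists (fun s w => pos_cert n m (s ++ R0) w (f (s, w)).1); split.
  by apply: computableb_pos_cert; comp.
move=> s w; split=> [pos|Hw]; first by apply/posE; exists (f (s, w)).1.
have := fP (s, w); rewrite /P => /orP[//|neg].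
by case: ((negE s w).2 _) => //; exists (f (s, w)).2.
Qed.

(** From here on only the decidability of membership, uniform in the generators
    of the subgroup, is used. *)
Section DecidableMembership.
Local Open Scope group_scope.
Variables (k : nat) (G : groupType) (gen : nat -> G).
Hypothesis gen1 : forall i, k <= i -> gen i = 1.
Hypothesis gen_surj : forall x, exists w, x = eval gen w.
Notation span s := (Defs.generated (words_set gen s)).
Variable member : seq (seq nat) -> seq nat -> bool.
Hypothesis computableb_member : computableb (fun c => member c.1 c.2).
Hypothesis memberE : forall s w, member s w <-> span s (eval gen w).

Let span1 s := subgroup1 (gen_subgroup gen s).
Let spanV s := @subgroupV _ _ (gen_subgroup gen s).
Let spanM s := @subgroupM _ _ (gen_subgroup gen s).
Let spanVM s := @subgroupVM _ _ (gen_subgroup gen s).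

Definition same_coset s u w := member s (u ++ winv w).

Lemma computableb_same_coset {C} {eC : Enc C} (s : C -> seq (seq nat)) u w :
  computable s -> computable u -> computable w ->
  computableb (fun c => same_coset (s c) (u c) (w c)).
Proof. by move=> cs cu cw; rewrite /same_coset; comp. Qed.

Lemma same_cosetP s u w :
  reflect (span s (eval gen u * (eval gen w)^-1)) (same_coset s u w).
Proof.
by apply: (iffP idP) => [/memberE|Huw]; last apply/memberE;
  rewrite eval_cat eval_winv.
Qed.

(** A list of words represents a transversal when the coset of [1] is covered,
    the covered cosets are closed under multiplication by letters, and no coset
    is covered twice. *)
Definition transversal_cert s (t : seq (seq nat)) :=
  [&& has (member s) t,
      all (fun u => all (fun l => has (same_coset s (u ++ [:: l])) t)
        (iota 0 k.*2)) t &
      all (fun i => all (fun j =>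
          (i == j) || ~~ same_coset s (nth [::] t i) (nth [::] t j))
        (iota 0 (size t))) (iota 0 (size t))].

Lemma computableb_transversal_cert {C} {eC : Enc C} (s t : C -> seq (seq nat)) :
  computable s -> computable t ->
  computableb (fun c => transversal_cert (s c) (t c)).
Proof. by move=> cs ct; rewrite /transversal_cert /same_coset; comp. Qed.

Lemma transversal_cert_cover s t : transversal_cert s t ->
  forall x, exists2 u, u \in t & span s (x * (eval gen u)^-1).
Proof.
case/and3P=> /hasP[u0 u0t /memberE Hu0] /allP step _ x.
have [w ->] := gen_surj x; elim/last_ind: w {x} => [|w l [u ut Hu]].
  by exists u0; rewrite // /eval /= mul1g; apply: spanV.
rewrite eval_rcons; case: (ltnP l k.*2) => [lt_l|le_l]; last first.
  exists u => //; rewrite /lval gen1; last by lia.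
  by rewrite invg1; case: ifP; rewrite mulg1.
have /allP/(_ l) := step u ut; rewrite mem_iota lt_l => /(_ isT) /hasP[u' u't].
move=> /same_cosetP; rewrite eval_cat {2}/eval /= mul1g => Hu'.
exists u' => //; rewrite -(mulgKV (eval gen u) (eval gen w)) -!mulgA mulgA.
by apply: spanM => //; rewrite !mulgA.
Qed.

Lemma transversal_cert_inj s t i j : transversal_cert s t ->
  i < size t -> j < size t ->
  span s (eval gen (nth [::] t i) * (eval gen (nth [::] t j))^-1) -> i = j.
Proof.
case/and3P=> _ _ /allP sep lt_i lt_j /same_cosetP Hij.
have := sep i; rewrite mem_iota lt_i => /(_ isT)/allP/(_ j).
by rewrite mem_iota lt_j Hij orbF => /(_ isT)/eqP.
Qed.

Lemma transversal_cert_ex s : finite_index (span s) -> exists t, transversal_cert s t.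
Proof.
move=> [ys ysP].
have subH := gen_subgroup gen s.
pose V := undup (map (rep (span s)) ys).
have [wd wdP] := choice gen_surj.
have cover x : exists2 v, v \in V & span s (x * v^-1).
  have [y yys Hy] := ysP x; exists (rep (span s) x).
    by rewrite mem_undup (rep_eq subH Hy) map_f.
  by apply: spanVM; apply: repP.
exists (map wd V); apply/and3P; split.
- have [v vV Hv] := cover 1; apply/hasP; exists (wd v); first exact: map_f.
  by apply/memberE; rewrite -wdP -[v]mulg1 -invg1; apply: spanVM.
- apply/allP => u _; apply/allP => l _.
  have [v vV Hv] := cover (eval gen (u ++ [:: l])).
  by apply/hasP; exists (wd v); [exact: map_f|apply/same_cosetP; rewrite -wdP].
- apply/allP => i; rewrite mem_iota size_map => lt_i.
  apply/allP => j; rewrite mem_iota => lt_j.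
  case: (boolP (same_coset _ _ _)); rewrite ?orbT // orbF => /same_cosetP.
  rewrite !(nth_map 1) // -!wdP => /(rep_eq subH) e.
  have repV v : v \in V -> rep (span s) v = v.
    by rewrite mem_undup => /mapP[y _ ->]; rewrite rep_rep.
  rewrite -(nth_uniq 1 lt_i lt_j (undup_uniq _)) -/V.
  by rewrite -(repV (nth 1 V i)) ?mem_nth // e repV ?mem_nth.
Qed.

(** The search is for a transversal or for a certificate of infinite index,
    whichever exists. *)
Lemma computable_transversal {X} {eX : Enc X}
    (inf : seq (seq nat) -> X -> bool) :
  computableb (fun c => inf c.1 c.2) -> inhabited X ->
  (forall s, ~ finite_index (span s) <-> exists x, inf s x) ->
  exists f : seq (seq nat) -> option (nat * seq (seq nat)), computable f /\
    forall s, if f s is Some (d, t') then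
        exists2 t, transversal_cert s t &
          d = size t /\ t' = map (fun w => [seq l <- w | l < k.*2]) t
      else ~ finite_index (span s).
Proof.
move=> cinf [x0] infE.
pose P s (x : seq (seq nat) * X) := transversal_cert s x.1 || inf s x.2.
have [f [cf fP _]] : exists f, [/\ computable f, forall s, P s (f s) &
    forall s x, P s x -> enc (f s) <= enc x].
  apply: computable_search => [s|].
    have [/transversal_cert_ex[t ht]|/infE[x hx]] := pselect (finite_index (span s)).
      by exists (t, x0); rewrite /P ht.
    by exists ([::], x); rewrite /P hx orbT.
  rewrite /P; apply: computableb_or; first by apply: computableb_transversal_cert; comp.
  by comp.
exists (fun s => if transversal_cert s (f s).1 then
  Some (size (f s).1, map (fun w => [seq l <- w | l < k.*2]) (f s).1) else None).
split; first by comp; apply: computableb_transversal_cert; comp.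
move=> s; case: ifP => [ht|nt]; first by exists (f s).1.
by apply/infE; exists (f s).2; have := fP s; rewrite /P nt.
Qed.

(** The word of least code in a coset: the search started from two words of the
    same coset has the same solutions. *)
Lemma computable_least_word : exists lw : seq (seq nat) -> seq nat -> seq nat, [/\
  computable (fun c => lw c.1 c.2),
  forall s w, span s (eval gen (lw s w) * (eval gen w)^-1) &
  forall s w w', span s (eval gen w * (eval gen w')^-1) -> lw s w = lw s w'].
Proof.
pose P (z : seq (seq nat) * seq nat) u := same_coset z.1 u z.2.
have [f [cf fP f_min]] : exists f, [/\ computable f, forall z, P z (f z) &
    forall z x, P z x -> enc (f z) <= enc x].
  apply: computable_search => [[s w]|].
    by exists w; apply/same_cosetP; rewrite mulgV; apply: span1.
  by apply: computableb_same_coset; comp.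
exists (fun s w => f (s, w)); split=> [|s w|s w w' Hw].
- by apply: eq_computable cf; case.
- exact/same_cosetP/(fP (s, w)).
have le v v' : span s (eval gen v * (eval gen v')^-1) ->
    enc (f (s, v)) <= enc (f (s, v')).
  move=> Hv; apply: (f_min (s, v)); apply/same_cosetP => /=.
  rewrite -(mulgKV (eval gen v') (eval gen (f _))) -mulgA.
  apply: spanM; last exact: spanVM.
  exact/same_cosetP/(fP (s, v')).
rewrite -[LHS]encK -[RHS]encK; congr dec.
by apply/eqP; rewrite eqn_leq !le //; apply: spanVM.
Qed.

(** The transversal consists of the elements represented by the least words of
    their cosets. Equality in the group is membership in the trivial subgroup,
    which is generated by the empty list. *)
Lemma computable_transversal_decider :
  exists D : seq (seq nat) -> seq nat -> bool,
    computableb (fun c => D c.1 c.2) /\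
    forall s, exists T : set G, right_transversal (span s) T /\
      forall w, D s w <-> T (eval gen w).
Proof.
have [lw [clw lwP lw_eq]] := computable_least_word.
exists (fun s w => same_coset [::] (lw s w) w); split.
  by apply: computableb_same_coset; comp.
have nilE u w : same_coset [::] u w <-> eval gen u = eval gen w.
  split=> [/same_cosetP/H_words[us [us0 e]]|e].
    by case: us us0 e => //= _ e; rewrite -[LHS](mulgKV (eval gen w)) e mul1g.
  by apply/same_cosetP; rewrite e mulgV; apply: span1.
move=> s.
exists [set x | exists w, x = eval gen w /\ eval gen (lw s w) = eval gen w]%classic.
split; last first.
  move=> w; rewrite nilE; split=> [e|[w' [e e']]]; first by exists w.
  by rewrite (@lw_eq s w w') e ?e' // mulgV; apply: span1.
move=> _ [x _ <-]; have [w ->] := gen_surj x.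
exists (eval gen (lw s w)); split; first split.
- by exists (lw s w); split=> //; congr eval; apply: lw_eq; apply: lwP.
- by exists (eval gen (lw s w) * (eval gen w)^-1); [apply: lwP|rewrite mulgKV].
move=> _ [[w' [-> ew']] [h Hh e]]; rewrite -ew'; congr eval.
by apply: lw_eq; apply: spanVM; rewrite -e mulgK.
Qed.
End DecidableMembership.

(** * Words over finitely many letters as lists of numbers *)

Lemma linv_code k (x : 'I_k * bool) : code_letter (letter_inv x) = linv (code_letter x).
Proof.
case: x => i b; rewrite /code_letter /letter_inv /linv /=.
by case: b; rewrite ?addn0 ?addn1 /= odd_double.
Qed.

Lemma code_letter_inj k : injective (@code_letter k).
Proof.
move=> [i b] [j c]; rewrite /code_letter /= => e.
have bc : b = c by have := congr1 odd e; rewrite !oddD !odd_double !oddb.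
by congr (_, _) => //; apply: val_inj => /=; move: e; rewrite bc => /addIn/double_inj.
Qed.

Lemma code_letter_lt k (x : 'I_k * bool) : code_letter x < k.*2.
Proof. by case: x => i b; rewrite /code_letter /=; have := ltn_ord i; case: b; lia. Qed.

Lemma code_letter_surj k l : l < k.*2 -> exists x : 'I_k * bool, code_letter x = l.
Proof.
move=> lt_l; have lt_i : l./2 < k by lia.
exists (Ordinal lt_i, odd l); rewrite /code_letter /= addnC; exact: odd_double_half.
Qed.

Definition raw k (w : word k) : seq nat := map (@code_letter k) w.

Lemma raw_valid k (w : seq nat) :
  exists tw : word k, raw tw = [seq l <- w | l < k.*2].
Proof.
elim: w => [|l w [tw e]]; first by exists [::].
rewrite /=; case: ifP => [/code_letter_surj[x <-]|_]; last by exists tw.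
by exists (x :: tw); rewrite /raw /= -e.
Qed.

Lemma code_wordE k (w : word k) : code_word w = enc (raw w).
Proof. by rewrite /code_word /raw /= map_id. Qed.

Lemma code_wordsE k (s : seq (word k)) : code_words s = enc (map (@raw k) s).
Proof.
rewrite /code_words [RHS]/= -map_comp; congr CodeSeq.code.
by apply: eq_map => w; apply: code_wordE.
Qed.

Section NatGenerators.
Local Open Scope group_scope.
Variables (G : groupType) (k : nat) (g : 'I_k -> G).

Definition nat_gen i : G := if insub i is Some j then g j else 1.

Lemma nat_gen_ord (j : 'I_k) : nat_gen j = g j.
Proof. by rewrite /nat_gen -[nat_of_ord j]/(val j) valK. Qed.

Lemma nat_gen_out i : k <= i -> nat_gen i = 1.
Proof. by move=> le_i; rewrite /nat_gen insubF // ltnNge le_i. Qed.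

Lemma lval_code x : lval nat_gen (code_letter x) = if x.2 then (g x.1)^-1 else g x.1.
Proof.
case: x => i b; rewrite /lval /code_letter /= oddD odd_double oddb /=.
rewrite halfD odd_double doubleK /= (_ : (0 + i + b./2)%N = i) ?nat_gen_ord //.
by case: b; rewrite addn0.
Qed.

Lemma eval_raw w : eval nat_gen (raw w) = eval_word g w.
Proof.
rewrite /eval_word; elim: w => [|x w IH]; first by rewrite big_nil.
by rewrite big_cons -IH /= eval_cons lval_code.
Qed.

Lemma words_set_raw s : words_set nat_gen (map (@raw k) s) = listed g s.
Proof.
apply/seteqP; split=> x /= [w ws ->].
  by move/mapP: ws => [tw tws ->]; exists tw; rewrite ?eval_raw.
by exists (raw w); rewrite ?map_f ?eval_raw.
Qed.

Lemma eval_valid w : eval nat_gen [seq l <- w | l < k.*2] = eval nat_gen w.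
Proof.
elim/last_ind: w => [//|w l IH]; rewrite filter_rcons eval_rcons -IH.
case: ltnP => [|le_l]; first by rewrite eval_rcons.
rewrite /lval nat_gen_out ?invg1; last by lia.
by case: ifP; rewrite mulg1.
Qed.
End NatGenerators.

(** * Cosets and the index *)

Section Cosets.
Local Open Scope group_scope.
Local Open Scope classical_set_scope.
Variables (G : groupType) (H : set G).
Hypothesis subH : is_subgroup H.

Lemma right_coset_mem x y : right_coset H x y <-> H (y * x^-1).
Proof.
split=> [[h Hh <-]|Hyx]; first by rewrite mulgK.
by exists (y * x^-1); rewrite ?mulgKV.
Qed.

Lemma right_coset_eq x y : right_coset H x = right_coset H y <-> H (x * y^-1).
Proof.
split=> [e|Hxy].
  by apply/right_coset_mem; rewrite -e right_coset_mem mulgV; apply: subgroup1.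
apply/seteqP; split=> z /right_coset_mem Hz; apply/right_coset_mem.
  by rewrite -(mulgKV x z) -mulgA; apply: subgroupM.
rewrite -(mulgKV y z) -mulgA; apply: subgroupM => //; exact: subgroupVM.
Qed.

Lemma finite_right_cosets : finite_set (right_cosets H) -> finite_index H.
Proof.
move=> /finite_seqP[cs csE].
have ex_rep (C : set G) : exists x, right_cosets H C -> C = right_coset H x.
  have [[x _ <-]|nC] := pselect (right_cosets H C); first by exists x.
  by exists 1.
have [f fP] := choice ex_rep.
exists (map f cs) => x.
have Cx : right_cosets H (right_coset H x) by exists x.
exists (f (right_coset H x)).
  by apply: map_f; move: Cx; rewrite csE.
by apply/right_coset_eq; exact: fP.
Qed.

Lemma right_cosets_card (t : seq G) :
  (forall x, exists2 u, u \in t & H (x * u^-1)) ->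
  (forall i j, i < size t -> j < size t ->
     H (nth 1 t i * (nth 1 t j)^-1) -> i = j) ->
  (right_cosets H #= `I_(size t))%card.
Proof.
move=> cover inj.
have -> : right_cosets H = (fun i => right_coset H (nth 1 t i)) @` `I_(size t).
  apply/seteqP; split=> [_ [x _ <-]|_ [i _ <-]]; last by eexists.
  have [u /(nthP 1)[i lt_i <-] Hu] := cover x.
  by exists i => //; apply/right_coset_eq; apply: subgroupVM.
apply: inj_card_eq => i j; rewrite !inE /= => lt_i lt_j /right_coset_eq.
exact: inj.
Qed.
End Cosets.

(** * The direct product of a free and an abelian group *)

Section FreeTimesAbelian.
Local Open Scope group_scope.
Variables (n m : nat) (A : groupType).
Hypothesis A_abelian : forall x y : A, commute x y.
Variable a : 'I_m -> A.
Hypothesis a_gen : Defs.generated (range a) = [set: A]%classic.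

Notation gen := (nat_gen (product_gens (n := n) a)).

Lemma mul_pair (x y : (free_group n * A)%type) : x * y = (x.1 * y.1, x.2 * y.2).
Proof. by []. Qed.

Lemma mul_fst (x y : (free_group n * A)%type) : (x * y).1 = x.1 * y.1.
Proof. by []. Qed.

Lemma inv_pair (x : (free_group n * A)%type) : x^-1 = (x.1^-1, x.2^-1).
Proof. by []. Qed.

Lemma gen_free (i : 'I_n) : gen i = (fg_gen i, 1).
Proof.
rewrite -[nat_of_ord i]/(nat_of_ord (lshift m i)) nat_gen_ord /product_gens.
by rewrite -[lshift m i]/(unsplit (inl i)) unsplitK.
Qed.

Lemma gen_abelian (j : 'I_m) : gen (n + j) = (1, a j).
Proof.
rewrite -[n + j]/(nat_of_ord (rshift n j)) nat_gen_ord /product_gens.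
by rewrite -[rshift n j]/(unsplit (inr j)) unsplitK.
Qed.

Lemma gen_out i : n + m <= i -> gen i = 1.
Proof. exact: nat_gen_out. Qed.

Lemma gen_fst i : n <= i -> (gen i).1 = 1.
Proof.
move=> le_i; case: (ltnP i (n + m)) => [lt_i|/gen_out->//].
have lt_j : i - n < m by lia.
by have := gen_abelian (Ordinal lt_j); rewrite /= subnKC // => ->.
Qed.

Lemma gen_commute i x : n <= i -> commute (gen i) x.
Proof.
move=> /gen_fst e; rewrite /commute !mul_pair e mul1g mulg1.
by congr (_, _); apply: A_abelian.
Qed.

(** Elements of the free group are reduced words, multiplied by [push]; the
    central letters contribute nothing to the first component. *)
Lemma fg_word_eval w : raw (fg_word (eval gen w).1) = freduce (fpart n w).
Proof.
elim: w => [//|l w IH]; rewrite eval_cons mul_fst.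
case: (ltnP l n.*2) => [/code_letter_surj[[i b] <-]|le_l]; last first.
  have -> : (lval gen l).1 = 1.
    have e : (gen l./2).1 = 1 by apply: gen_fst; lia.
    by rewrite /lval; case: ifP => _; rewrite ?inv_pair /= e ?invg1.
  rewrite mul1g IH /= ltnNge; have -> : n.*2 <= l by [].
  by [].
have -> : (lval gen (code_letter (i, b))).1 = (if b then (fg_gen i)^-1 else fg_gen i).
  rewrite /lval /code_letter /= oddD odd_double oddb /= halfD odd_double doubleK /=.
  rewrite (_ : (0 + i + b./2)%N = i); last by case: (b); rewrite addn0.
  by rewrite gen_free; case: (b).
have -> : fg_word ((if b then (fg_gen i)^-1 else fg_gen i) * (eval gen w).1)
    = push (i, b) (fg_word (eval gen w).1) by case: (b).
have -> : fpart n (code_letter (i, b) :: w) = code_letter (i, b) :: fpart n w.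
  by rewrite /fpart /= code_letter_lt.
rewrite -[freduce _]/(rpush _ (freduce (fpart n w))) -IH.
case: (fg_word _) => [//|y u] /=.
by rewrite -linv_code (inj_eq (@code_letter_inj _)); case: ifP.
Qed.

Lemma gen_freduce w : eval gen w = 1 -> freduce (fpart n w) = [::].
Proof. by move=> e; rewrite -fg_word_eval e. Qed.

Lemma eval_free (u : free_group n) : exists b, eval gen (raw (fg_word u)) = (u, b).
Proof.
exists (eval gen (raw (fg_word u))).2.
rewrite [LHS]surjective_pairing; congr (_, _); apply: val_inj => /=.
apply: (inj_map (@code_letter_inj n)); rewrite -!/(raw _) fg_word_eval.
rewrite /fpart (all_filterP _); last first.
  by apply/allP => l /mapP[x _ ->]; apply: code_letter_lt.
have e : foldr (@push n) [::] (fg_word u) = fg_word u.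
  by have /(congr1 (@fg_word n)) := @fg_mulr1 n u.
rewrite -[in RHS]e; elim: (fg_word u) => //= x w ->.
case: (foldr _ _ _) => [//|y v] /=.
by rewrite -linv_code (inj_eq (@code_letter_inj _)); case: ifP.
Qed.

Lemma eval_abelian (b : A) : exists w, eval gen w = (1, b).
Proof.
have : Defs.generated (range a) b by rewrite a_gen.
move=> /(_ [set b | exists w, eval gen w = (1, b)]%classic); apply; split.
  split=> [|x y [u eu] [w ew]]; first by exists [::].
  exists (u ++ winv w); rewrite eval_cat eval_winv eu ew.
  by rewrite inv_pair mul_pair /= invg1 mulg1.
move=> _ [j _ <-]; exists [:: (n + j).*2].
by rewrite /eval /= mul1g /lval odd_double doubleK gen_abelian.
Qed.

Lemma gen_surjective x : exists w, x = eval gen w.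
Proof.
case: x => u b; have [b' e] := eval_free u.
have [w ew] := eval_abelian (b'^-1 * b).
exists (raw (fg_word u) ++ w); rewrite eval_cat e ew mul_pair /=.
by rewrite mulg1 mulKVg.
Qed.
End FreeTimesAbelian.

Local Open Scope group_scope.
Local Open Scope classical_set_scope.

Theorem proposition5p2 (n : nat) (A : groupType)
    (A_abelian : forall x y : A, commute x y)
    (m : nat) (a : 'I_m -> A) (a_gen : generated (range a) = [set: A]) :
  finite_index_problem_solvable (product_gens (n := n) a) /\
  recursive_transversals_computable (product_gens (n := n) a).
Proof.
set g := product_gens a.
pose gen := nat_gen g.
have gen1 i : n + m <= i -> gen i = 1 by apply: gen_out.
have gen_surj x : exists w, x = eval gen w by apply: gen_surjective.
have [R0 certR0] := certificates gen1 (@gen_commute n m A A_abelian a)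
  (@gen_freduce n m A a) gen_surj.
have [member [cmember memberE]] : exists member : seq (seq nat) -> seq nat -> bool,
    computableb (fun c => member c.1 c.2) /\
    forall s w, member s w <-> generated (words_set gen s) (eval gen w).
  by apply: (@computable_membership n m _ gen R0) => s w; have [] := certR0 s.
have spanE s : generated (listed g s) = generated (words_set gen (map (@raw _) s)).
  by rewrite words_set_raw.
split.
  have [f [[p pP] fP]] : exists f : seq (seq nat) -> option (nat * seq (seq nat)),
      computable f /\ forall s, if f s is Some (d, t') then
        exists2 t, transversal_cert (n + m) member s t &
          d = size t /\ t' = map (fun w => [seq l <- w | l < (n + m).*2]) t
      else ~ finite_index (generated (words_set gen s)).
    apply: (computable_transversal (n + m) gen_surj cmember memberE
      (inf := fun s => inf_cert n m (s ++ R0))).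
    - by apply: computableb_inf_cert; comp.
    - by constructor; exact: ((0, (0, [::])), ([::], [::])).
    - by move=> s; have [] := certR0 s.
  exists p => s H.
  have subH : is_subgroup H by rewrite /H spanE; apply: gen_subgroup.
  have := pP (map (@raw _) s); rewrite -code_wordsE.
  have := fP (map (@raw _) s); rewrite -spanE -/H.
  case: (f _) => [[d t'] [t tP [-> ->]]|ninf] comp_s; last first.
    left; split=> // fin; apply: ninf; exact: finite_right_cosets subH fin.
  right; have [tr trE] := choice (@raw_valid (n + m)).
  have evalE w : eval_word g (tr w) = eval gen w.
    by rewrite -eval_raw trE eval_valid.
  have cover := transversal_cert_cover gen1 gen_surj memberE tP.
  have inj i j := transversal_cert_inj memberE tP (i := i) (j := j).
  rewrite -spanE -/H in cover inj.
  exists (size t), (map tr t); split.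
  - rewrite -(size_map (eval gen)); apply: right_cosets_card => // [x|i j].
      by have [u ut Hu] := cover x; exists (eval gen u); rewrite ?map_f.
    rewrite size_map => lt_i lt_j; rewrite !(nth_map [::]) //; exact: inj.
  - move=> _ [x _ <-]; have [u ut Hu] := cover x.
    exists (eval gen u); split; first split.
    + by exists (tr u); rewrite ?map_f ?evalE.
    + by apply/right_coset_mem; apply: (subgroupVM subH).
    move=> _ [[_ /mapP[u' u't ->] ->]]; rewrite evalE => /right_coset_mem Hu'.
    have /(nthP [::])[i lt_i iE] := ut; have /(nthP [::])[j lt_j jE] := u't.
    suff ij : i = j by rewrite -iE -jE ij.
    apply: inj => //; rewrite iE jE -(mulgKV x (eval gen u)) -mulgA.
    exact: (subgroupM subH (subgroupVM subH Hu) (subgroupVM subH Hu')).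
  - have -> : code_words (map tr t)
        = enc (map (fun w => [seq l <- w | l < (n + m).*2]) t).
      by rewrite code_wordsE -map_comp; congr enc; apply: eq_map.
    exact: comp_s.
have [D [cD DP]] := computable_transversal_decider gen_surj cmember memberE.
have [r [[q qP] rP]] := computable_smn cD.
exists q => s H; have [T [transT DT]] := DP (map (@raw _) s).
exists (r (map (@raw _) s)), T; split.
- by rewrite code_wordsE; apply: qP.
- by move: transT; rewrite words_set_raw.
move=> w; rewrite code_wordE -eval_raw; have := rP (map (@raw _) s) (raw w).
by congr (computes _ _ (nat_of_bool _)); apply/idP/asboolP; rewrite DT.
Qed.
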